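(* Let $d\ge 1$ and let $X:\Omega\times\mathbb{R}^d\to\mathbb{R}$ be a Gaussian random field with $C^\infty$ sample paths and with variance bounded below, i.e. there exists $\kappa>0$ such that $\operatorname{Var}(X(t))>\kappa$ for all $t\in\mathbb{R}^d$. Let $u\in\mathbb{R}$. Then for every integer $m\ge 1$ and every compact set $K\subset\mathbb{R}^d$, with $C_{u,K}:=\{t\in K: X(t)=u\}$, $$\mathbb{E}\Big[\big(\mathcal{I}_{d-1}(C_{u,K})\big)^m\Big]<\infty.$$
   Context: Integral geometric measure: for a Borel set $B\subset\mathbb{R}^d$, $$\mathcal{I}_{d-1}(B):=c_{d-1}\int_{v\in S^{d-1}}\left(\int_{y\in v^\perp}\#\{B\cap \ell_{v,y}\}\,d\mathcal{H}_{d-1}(y)\right)dS^{d-1}(v)\in[0,+\infty],$$ where $S^{d-1}$ is the unit sphere of $\mathbb{R}^d$ and $dS^{d-1}$ is its induced Riemannian measure (counting measure on $\{-1,1\}$ if $d=1$), $v^\perp$ is the hyperplane orthogonal to $v$, $\mathcal{H}_{d-1}$ is $(d-1)$-dimensional Hausdorff measure, $\ell_{v,y}:=\{y+tv: t\in\mathbb{R}\}$, $\#$ denotes the number of points (possibly $+\infty$), and $$c_{d-1}=\frac{\Gamma\left(\frac{d+1}{2}\right)}{2\pi^{(d-1)/2}}.$$ *)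

(* Defs.v *)
From mathcomp Require Import all_boot all_order all_algebra.
From mathcomp Require Import all_classical all_reals all_analysis.
Import Order.TTheory GRing.Theory Num.Theory.
Import numFieldNormedType.Exports.

Set Implicit Arguments.
Unset Strict Implicit.
Unset Printing Implicit Defensive.

Local Open Scope classical_set_scope.
Local Open Scope ring_scope.

Definition Gamma {R : realType} (x : R) : R :=
  fine (\int[lebesgue_measure]_(t in `]0%R, +oo[)
          (t `^ (x - 1) * expR (- t))%:E)%E.

(* The library norm on row vectors is the sup norm; it induces the usual
   topology of R^d, but lengths and diameters below are Euclidean. *)
Definition dotv {R : realType} {d : nat} (v w : 'rV[R]_d) : R :=
  \sum_(i < d) v 0 i * w 0 i.

Definition norm2 {R : realType} {d : nat} (v : 'rV[R]_d) : R :=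
  Num.sqrt (dotv v v).

Notation borelRd R d := (g_sigma_algebraType (@open 'rV[R]_d)).

(* equal to -oo on the empty set *)
Definition diam2 {R : realType} {d : nat} (U : set 'rV[R]_d) : \bar R :=
  ereal_sup [set (norm2 (p.1 - p.2))%:E | p in U `*` U].

(* The volume of the k-dimensional Euclidean ball of diameter 1,
   pi^(k/2) / (Gamma(k/2 + 1) 2^k).  With this normalization the k-dimensional
   Hausdorff measure is Lebesgue measure on k-planes, and is the Riemannian
   measure on k-dimensional submanifolds. *)
Definition hausdorff_const (R : realType) (k : nat) : R :=
  pi `^ (k%:R / 2) / (Gamma (k%:R / 2 + 1) * 2 ^+ k).

(* A nonempty set of diameter 0 has weight 1 when k = 0, while the empty set
   always has weight 0; hence the 0-dimensional measure counts points. *)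
Definition hausdorff_weight {R : realType} {d : nat} (k : nat)
    (U : set 'rV[R]_d) : \bar R :=
  if U == set0 then 0%E else ((hausdorff_const R k)%:E * diam2 U ^+ k)%E.

Definition hausdorff_pre {R : realType} {d : nat} (k : nat) (delta : R)
    (A : set 'rV[R]_d) : \bar R :=
  ereal_inf [set (\sum_(0 <= i <oo) hausdorff_weight k (U i))%E |
    U in [set U : nat -> set 'rV[R]_d |
            A `<=` \bigcup_i U i /\ forall i, (diam2 (U i) <= delta%:E)%E]].

Definition hausdorff {R : realType} {d : nat} (k : nat)
    (A : set (borelRd R d)) : \bar R :=
  ereal_sup [set hausdorff_pre k delta A | delta in [set delta : R | 0 < delta]].

Definition sphere {R : realType} {d : nat} : set (borelRd R d) :=
  [set v | norm2 v = 1].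

Definition perp {R : realType} {d : nat} (v : 'rV[R]_d) : set (borelRd R d) :=
  [set y | dotv y v = 0].

Definition line {R : realType} {d : nat} (v y : 'rV[R]_d) : set 'rV[R]_d :=
  [set y + t *: v | t in [set: R]].

(* Meant for d >= 1: it is the integral geometric measure I_{d-1} on R^d.  The
   induced Riemannian measure of the unit sphere is taken to be its
   (d-1)-dimensional Hausdorff measure (the counting measure when d = 1). *)
Definition integral_geometric {R : realType} {d : nat} (B : set 'rV[R]_d) :
    \bar R :=
  ((Gamma (d.+1%:R / 2) / (2 * pi `^ (d.-1%:R / 2)))%:E *
   \int[hausdorff d.-1]_(v in @sphere R d)
     \int[hausdorff d.-1]_(y in perp v) counting (B `&` line v y))%E.

Fixpoint is_Ck {R : realType} {d : nat} (k : nat) (f : 'rV[R]_d -> R) : Prop :=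
  match k with
  | 0 => continuous f
  | k'.+1 => continuous f /\
      forall i : 'I_d, (forall x, derivable f x (delta_mx 0 i)) /\
        is_Ck k' (fun x => 'D_(delta_mx 0 i) f x)
  end.

Definition smooth {R : realType} {d : nat} (f : 'rV[R]_d -> R) : Prop :=
  forall k, is_Ck k f.

(* normal_prob m 0 is a junk value in the library; the degenerate Gaussian law
   is the Dirac mass. *)
Definition gaussian_law {R : realType} (m s : R) (A : set R) : \bar R :=
  if s == 0 then \d_m A else normal_prob m s A.

Definition is_gaussian d (T : measurableType d) (R : realType)
    (P : probability T R) (Y : T -> R) : Prop :=
  exists m s : R, forall A : set R, measurable A ->
    P (Y @^-1` A) = gaussian_law m s A.

(* Every finite linear combination of the X t is Gaussian, i.e. all
   finite-dimensional marginals are (possibly degenerate, not necessarily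
   centered) Gaussian vectors. *)
Definition gaussian_field d (T : measurableType d) (R : realType)
    (P : probability T R) (I : Type) (X : I -> {RV P >-> R}) : Prop :=
  forall (n : nat) (t : 'I_n -> I) (a : 'I_n -> R),
    is_gaussian P (fun w => \sum_(i < n) a i * X (t i) w).

Definition level_set {R : realType} {d : nat} (f : 'rV[R]_d -> R) (u : R)
    (K : set 'rV[R]_d) : set 'rV[R]_d :=
  [set t | K t /\ f t = u].

(* Main.v *)
(** Let [N(v, y)] be the number of points of the level set on the line through
    [y] with direction [v].  Cut this line into intervals of length [1/n].  If
    [N(v, y)] exceeds a multiple of [n], some interval contains [k] zeros of
    [X - u] and Rolle's theorem bounds [|X - u|] on it by [n^-k] times a bound
    for the [k]-th derivatives, hence by a multiple of [n^(1-k)] as long as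
    these derivatives are at most [3 n] on a large ball.  Then [|X - u|] is
    that small at some [n^(k-1)] points, close to the interval, of a lattice of
    mesh of order [n^-k].  Counting these lattice points, instead of integrating
    over lines, bounds the integral of [N] over [y], uniformly in [v], by a
    series over [n = 2^j] with terms [4^j V_j], where [V_j] is the proportion of
    bad lattice points.  No Fubini theorem is needed, and only one-dimensional
    Gaussian laws enter: since the variance is bounded below, a lattice point is
    bad with probability [O(n^(1-k))], up to the probability that a derivative
    exceeds [3 n], which decays faster than any power of [n] by a chaining
    argument.  Taking [k] large compared to [m] gives the [m]-th moment.  *)

From HB Require Import structures.
Require Import Defs.
From mathcomp Require Import all_boot all_order all_algebra.
From mathcomp Require Import all_classical all_reals all_analysis measurable_realfun.
From mathcomp Require Import ring lra zify.
Import Order.TTheory GRing.Theory Num.Theory.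
Import numFieldNormedType.Exports.

Set Implicit Arguments.
Unset Strict Implicit.
Unset Printing Implicit Defensive.

Local Open Scope classical_set_scope.
Local Open Scope ring_scope.

(** * The Hausdorff measure *)

(** Only upper bounds are proved, each by a measurable majorant: the number of points as a function
    of [y], its integral as a function of [v] and the final integrand as a function of [w] are never
    shown to be measurable. The factor 4^j arises as follows. Let n = 2^j, let D be the dimension
    and h, of order n^k, the inverse mesh. A line with more than about n points is charged to
    n^(k-1) bad lattice points, and each bad point is charged only by the [y] in a box of measure
    about h^(1-D). Hence level j costs about n * n^(1-k) * h^(1-D) per bad point, which is n^2 times
    its share h^(-D) of the lattice. Since the V_j are bounded by a constant C, V_j^m is at most
    C^(m-1) V_j. This makes the estimate of the m-th moment linear in the V_j, so that expectations
    of single indicators suffice. The price is a weight n^(3m), and it determines k = 3m + 2.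
    Derivatives of the field are limits of Gaussian combinations. Instead of identifying their laws,
    the proof carries a tail estimate through the limit. *)

Lemma cvg_sumr {R : realType} {T I : Type} (F : set_system T) {FF : Filter F}
    (r : seq I) (f : I -> T -> R) (l : I -> R) :
  (forall i, f i x @[x --> F] --> l i) ->
  \sum_(i <- r) f i x @[x --> F] --> \sum_(i <- r) l i.
Proof.
move=> fl; elim: r => [|i r ih].
  by rewrite big_nil; under eq_fun do rewrite big_nil; exact: cvg_cst.
by rewrite big_cons; under eq_fun do rewrite big_cons; exact: cvgD.
Qed.

Section euclidean.
Context {R : realType} {d : nat}.
Implicit Types x y v : 'rV[R]_d.

Lemma normr_coord x (i : 'I_d) : `|x 0 i| <= `|x|.
Proof.
rewrite [leRHS]/Num.norm/= mx_normrE.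
exact: (@le_bigmax_cond _ _ _ _ (0, i) xpredT (fun ij => `|x ij.1 ij.2|)).
Qed.

Lemma normr_rowP x (e : R) : 0 <= e -> (forall i, `|x 0 i| <= e) -> `|x| <= e.
Proof.
move=> e0 xe; rewrite [leLHS]/Num.norm/= mx_normrE; apply: bigmax_le => // -[a b] _ /=.
by rewrite (ord1 a).
Qed.

Lemma dotvv_ge0 x : 0 <= dotv x x.
Proof. by apply: sumr_ge0 => i _; rewrite -expr2 sqr_ge0. Qed.

Lemma norm2_ge0 x : 0 <= norm2 x. Proof. exact: sqrtr_ge0. Qed.

Lemma norm2_sqr x : norm2 x ^+ 2 = dotv x x.
Proof. by rewrite sqr_sqrtr// dotvv_ge0. Qed.

Lemma coord_le_norm2 x i : `|x 0 i| <= norm2 x.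
Proof.
rewrite -sqrtr_sqr ler_wsqrtr// expr2 /dotv (bigD1 i)//= lerDl.
by apply: sumr_ge0 => j _; rewrite -expr2 sqr_ge0.
Qed.

Lemma normr_le_norm2 x : `|x| <= norm2 x.
Proof. by apply: normr_rowP; [exact: norm2_ge0|exact: coord_le_norm2]. Qed.

Lemma norm2_le x (e : R) : 0 <= e -> (forall i, `|x 0 i| <= e) ->
  norm2 x <= d%:R * e.
Proof.
move=> e0 xe; rewrite -(@ler_pXn2r _ 2)// ?nnegrE ?norm2_ge0 ?mulr_ge0//.
rewrite norm2_sqr /dotv (@le_trans _ _ (\sum_(i < d) e ^+ 2))//.
  by apply: ler_sum => i _; rewrite -expr2 -real_normK ?num_real// lerXn2r ?nnegrE.
rewrite sumr_const card_ord -[leLHS]mulr_natl exprMn; apply: ler_wpM2r.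
  exact: sqr_ge0.
by rewrite -natrX ler_nat; case: (d) => // n; rewrite leq_pmulr.
Qed.

Lemma dotv_continuous v : continuous (fun y => dotv y v).
Proof.
move=> y; apply: (@cvg_sumr _ _ _ (nbhs y) (nbhs_filter y)) => i.
by apply: (@cvgMr_tmp _ _ (nbhs y) (nbhs_filter y)); exact: coord_continuous.
Qed.

End euclidean.

Section hausdorff_pre.
Context {R : realType} {d : nat}.
Implicit Types (k : nat) (delta : R) (A B U : set 'rV[R]_d).

Lemma Gamma_ge0 (x : R) : 0 <= Gamma x.
Proof.
apply/fine_ge0/integral_ge0 => t _.
by rewrite lee_fin mulr_ge0 ?powR_ge0 ?expR_ge0.
Qed.

Lemma hausdorff_const_ge0 k : 0 <= hausdorff_const R k.
Proof. by rewrite divr_ge0 ?powR_ge0// mulr_ge0 ?Gamma_ge0. Qed.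

Lemma norm2_le_diam2 U x y : U x -> U y -> ((norm2 (x - y))%:E <= diam2 U)%E.
Proof. by move=> Ux Uy; apply: ereal_sup_ubound; exists (x, y). Qed.

Lemma diam2_ge0 U : U != set0 -> (0 <= diam2 U)%E.
Proof.
move=> /set0P[x Ux]; apply: le_trans (norm2_le_diam2 Ux Ux).
by rewrite lee_fin norm2_ge0.
Qed.

Lemma hausdorff_weight_ge0 k U : (0 <= hausdorff_weight k U)%E.
Proof.
rewrite /hausdorff_weight; case: ifPn => // U0.
by rewrite mule_ge0 ?lee_fin ?hausdorff_const_ge0// expe_ge0// diam2_ge0.
Qed.

Lemma hausdorff_weight0 k : hausdorff_weight k (set0 : set 'rV[R]_d) = 0%E.
Proof. by rewrite /hausdorff_weight eqxx. Qed.

Lemma diam20 : diam2 (set0 : set 'rV[R]_d) = -oo%E.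
Proof.
rewrite /diam2 (_ : [set _ | _ in _] = set0) ?ereal_sup0//.
by apply/seteqP; split=> // x [p []].
Qed.

Lemma hausdorff_pre_ge0 k delta A : (0 <= hausdorff_pre k delta A)%E.
Proof.
apply: le_ereal_inf_tmp => _ [U _ <-].
by apply: nneseries_ge0 => n _ _; exact: hausdorff_weight_ge0.
Qed.

Lemma hausdorff_pre_le k delta A (U : nat -> set 'rV[R]_d) :
  A `<=` \bigcup_i U i -> (forall i, (diam2 (U i) <= delta%:E)%E) ->
  (hausdorff_pre k delta A <= \sum_(0 <= i <oo) hausdorff_weight k (U i))%E.
Proof. by move=> AU dU; apply: ereal_inf_lbound; exists U. Qed.

Lemma hausdorff_pre0 k delta : hausdorff_pre k delta (set0 : set 'rV[R]_d) = 0%E.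
Proof.
apply/eqP; rewrite eq_le hausdorff_pre_ge0 andbT.
apply: le_trans (@hausdorff_pre_le k delta _ (fun=> set0) _ _) _ => //.
  by move=> i; rewrite diam20 leNye.
by rewrite eseries0// => i _ _; rewrite hausdorff_weight0.
Qed.

Lemma le_hausdorff_pre k delta A B : A `<=` B ->
  (hausdorff_pre k delta A <= hausdorff_pre k delta B)%E.
Proof.
move=> AB; apply/ereal_inf_le_tmp => x [U [BU dU] <-]; exists U => //.
by split => //; apply: subset_trans BU.
Qed.

(* The library's outer measure [mu_ext] is built on a semiring of sets; here
   every set is declared measurable, and the size constraint on the covering
   sets becomes an infinite weight. *)
Lemma hausdorff_preE k delta A : hausdorff_pre k delta A =
  mu_ext (fun U : set (g_sigma_algebraType [set: set 'rV[R]_d]) =>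
    if (diam2 U <= delta%:E)%E then hausdorff_weight k U else +oo%E) A.
Proof.
apply/eqP; rewrite eq_le; apply/andP; split.
  apply: le_ereal_inf_tmp => _ [U [mU AU] <-].
  have [dU|] := pselect (forall i, (diam2 (U i) <= delta%:E)%E).
    by under eq_eseriesr do rewrite dU; exact: hausdorff_pre_le.
  move=> /existsNP[i /negP/negbTE dU]; rewrite (@eseries_pinfty _ _ _ i) ?leey ?dU//.
  by move=> n _; case: ifP => // _; rewrite gt_eqF// (lt_le_trans _ (hausdorff_weight_ge0 _ _)).
apply: le_ereal_inf_tmp => _ [U [AU dU] <-]; apply: ereal_inf_lbound.
exists U; last by under eq_eseriesr do rewrite dU.
by split => // n; exact: sub_sigma_algebra.
Qed.

Lemma hausdorff_pre_sigma_subadditive k delta :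
  sigma_subadditive (hausdorff_pre k delta : set 'rV[R]_d -> \bar R).
Proof.
move=> A; rewrite hausdorff_preE; under eq_eseriesr do rewrite hausdorff_preE.
apply: mu_ext_sigma_subadditive => U; case: ifP => // _.
exact: hausdorff_weight_ge0.
Qed.

End hausdorff_pre.

Section hausdorff_measure.
Context {R : realType} {d : nat} (k : nat).
Implicit Types (delta e : R) (A B X F : set 'rV[R]_d).
Local Notation H := (@hausdorff R d k).

Lemma hausdorff_ge0 A : (0 <= H A)%E.
Proof.
apply: le_trans (hausdorff_pre_ge0 k 1 A) _.
by apply: ereal_sup_ubound; exists 1 => //=; exact: ltr01.
Qed.

Lemma hausdorff0 : H set0 = 0%E.
Proof.
apply/eqP; rewrite eq_le hausdorff_ge0 andbT.
by apply: ge_ereal_sup => _ [delta _ <-]; rewrite hausdorff_pre0.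
Qed.

Lemma le_hausdorff : {homo H : A B / A `<=` B >-> (A <= B)%E}.
Proof.
move=> A B AB; apply: ge_ereal_sup => _ [delta d0 <-].
apply: le_trans (le_hausdorff_pre k delta AB) _.
by apply: ereal_sup_ubound; exists delta.
Qed.

Lemma hausdorff_sigma_subadditive : sigma_subadditive H.
Proof.
move=> F; apply: ge_ereal_sup => _ [delta d0 <-].
apply: le_trans (hausdorff_pre_sigma_subadditive k delta F) _.
apply: lee_nneseries => n _; first by move=> _; exact: hausdorff_pre_ge0.
by apply: ereal_sup_ubound; exists delta.
Qed.

HB.instance Definition _ := isOuterMeasure.Build R (borelRd R d) H
  hausdorff0 hausdorff_ge0 le_hausdorff hausdorff_sigma_subadditive.

(** A covering set of Euclidean diameter below [e] cannot meet both sets, because the sup norm is at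
    most the Euclidean one. So a covering of the union splits into two; the discarded sets become
    empty and weigh 0, even for [k = 0]. *)
Lemma hausdorff_pre_separated delta e A B : delta < e ->
  (forall x y, A x -> B y -> e <= `|x - y|) ->
  (hausdorff_pre k delta A + hausdorff_pre k delta B <=
     hausdorff_pre k delta (A `|` B))%E.
Proof.
move=> de sAB; apply: le_ereal_inf_tmp => _ [U [ABU dU] <-].
pose meeting C i := if `[< U i `&` C !=set0 >] then U i else set0.
have mle C i : (diam2 (meeting C i) <= delta%:E)%E.
  by rewrite /meeting; case: ifP => // _; rewrite diam20 leNye.
have mcov C : C `<=` A `|` B -> C `<=` \bigcup_i meeting C i.
  move=> CAB x Cx; have [i _ Uix] := ABU x (CAB x Cx); exists i => //.
  by rewrite /meeting; case: asboolP => // -[]; exists x.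
apply: (@le_trans _ _ (\sum_(i <oo) hausdorff_weight k (meeting A i) +
    \sum_(i <oo) hausdorff_weight k (meeting B i))%E).
  by apply: leeD; apply: hausdorff_pre_le => //; apply: mcov => x; [left|right].
rewrite -nneseriesD; [|by move=> *; exact: hausdorff_weight_ge0..].
apply: lee_nneseries => i _; first by move=> _; rewrite adde_ge0 ?hausdorff_weight_ge0.
rewrite /meeting; case: asboolP => [[x [Ux Ax]]|_]; last first.
  by rewrite hausdorff_weight0 add0e; case: ifP => // _;
    rewrite hausdorff_weight0 hausdorff_weight_ge0.
case: asboolP => [[y [Uy By]]|_]; last by rewrite hausdorff_weight0 adde0.
have := le_trans (norm2_le_diam2 Ux Uy) (dU i); rewrite lee_fin => nd.
by have := lt_le_trans (le_lt_trans nd de) (sAB _ _ Ax By);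
  rewrite ltNge normr_le_norm2.
Qed.

Lemma hausdorff_pre_anti delta1 delta2 A : delta1 <= delta2 ->
  (hausdorff_pre k delta2 A <= hausdorff_pre k delta1 A)%E.
Proof.
move=> d12; apply/ereal_inf_le_tmp => x [U [AU dU] <-]; exists U => //.
by split => // i; apply: le_trans (dU i) _; rewrite lee_fin.
Qed.

Lemma hausdorff_separated e A B : 0 < e ->
  (forall x y, A x -> B y -> e <= `|x - y|) -> (H A + H B <= H (A `|` B))%E.
Proof.
move=> e0 sAB; have [->|fAB] := eqVneq (H (A `|` B)) +oo%E; first by rewrite leey.
have {}fAB : H (A `|` B) \is a fin_num.
  by rewrite ge0_fin_numE ?hausdorff_ge0// lt_neqAle fAB leey.
have fin C : C `<=` A `|` B -> H C \is a fin_num.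
  move=> /le_hausdorff/le_lt_trans CAB; rewrite ge0_fin_numE ?hausdorff_ge0//.
  by apply: CAB; rewrite -ge0_fin_numE ?hausdorff_ge0.
have fA : H A \is a fin_num by apply: fin => x; left.
have fB : H B \is a fin_num by apply: fin => x; right.
rewrite -leeBrDl//; apply: ge_ereal_sup => _ [delta2 d20 <-].
have f2 : hausdorff_pre k delta2 B \is a fin_num.
  rewrite ge0_fin_numE ?hausdorff_pre_ge0//; apply: (@le_lt_trans _ _ (H B)).
    by apply: ereal_sup_ubound; exists delta2.
  by rewrite -ge0_fin_numE ?hausdorff_ge0.
rewrite leeBrDl// -leeBrDr//; apply: ge_ereal_sup => _ [delta1 d10 <-].
rewrite leeBrDr//.
(* The measures of [A] and [B] are suprema over independent scales. A common scale below both, and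
   strictly below [e], serves the union. *)
pose delta := Num.min (Num.min delta1 delta2) (e / 2).
have d0 : 0 < delta by rewrite !lt_min d10 d20 divr_gt0.
apply: (@le_trans _ _ (hausdorff_pre k delta (A `|` B))); last first.
  by apply: ereal_sup_ubound; exists delta.
apply: le_trans (@hausdorff_pre_separated delta e _ _ _ sAB); last first.
  by rewrite gt_min ltr_pdivrMr// ltr_pMr// ltr1n orbT.
by apply: leeD; apply: hausdorff_pre_anti; rewrite !ge_min lexx ?orbT.
Qed.

(** Carathéodory's criterion for metric outer measures. The sets [E n] keep a distance from [F] and
    exhaust the part of [X] outside [F]; additivity is known for [E n] and [F], and the layers [D n]
    between consecutive [E n] measure the error. *)
Lemma closed_caratheodory F : closed F -> H.-caratheodory F.
Proof.
move=> cF; apply: le_caratheodory_measurable => X.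
have [HX|fX] := eqVneq (H X) +oo%E; first by rewrite [leRHS]HX leey.
have {}fX : H X \is a fin_num.
  by rewrite ge0_fin_numE ?hausdorff_ge0// lt_neqAle fX leey.
pose E n := X `&` [set x | forall y, F y -> n.+1%:R^-1 <= `|x - y|].
pose D n := E n.+1 `\` E n.
have EX n : E n `<=` X by move=> x [].
have Ele m n : (m <= n)%N -> E m `<=` E n.
  move=> mn x [Xx Ex]; split => // y Fy; apply: le_trans (Ex y Fy).
  by rewrite lef_pV2 ?posrE// ler_nat.
have FE n : (H (X `&` F) + H (E n) <= H X)%E.
  apply: (@le_trans _ _ (H ((X `&` F) `|` E n))).
    apply: (@hausdorff_separated n.+1%:R^-1) => // x y [_ Fx] [_ Ey].
    by rewrite distrC; exact: Ey.
  by apply: le_hausdorff => x [[]|[]].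
have DE n : (H (E n) + H (D n.+1) <= H (E n.+2))%E.
  apply: (@le_trans _ _ (H (E n `|` D n.+1))).
    apply: (@hausdorff_separated (n.+1%:R^-1 - n.+2%:R^-1)).
      by rewrite subr_gt0 ltf_pV2 ?posrE// ltr_nat.
    move=> x y [_ Ex] [[Xy Ey] nEy].
    have [z Fz yz] : exists2 z, F z & `|y - z| < n.+2%:R^-1.
      apply: contrapT => h; apply: nEy; split => // z Fz.
      by rewrite leNgt; apply/negP => yz; apply: h; exists z.
    rewrite lerBlDr (le_trans (Ex z Fz))// (le_trans (ler_distD y _ _))//.
    by rewrite lerD2l ltW.
  by apply: le_hausdorff => x [|[]//]; apply: Ele; rewrite leqW.
(* Layers of the same parity are mutually separated, so their measures add up to at most [H X].
   Taking both parities together, the series of all layers is bounded by [2 H X], and its tails tend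
   to 0. *)
have Dsum b n : (\sum_(i < n) H (D (i.*2 + b)%N.+1) <= H (E (n.*2 + b)%N))%E.
  elim: n => [|n ih]; first by rewrite big_ord0 hausdorff_ge0.
  by rewrite big_ord_recr/= doubleS !addSn; apply: le_trans (DE _); rewrite leeD2r.
have Dsum2 n : (\sum_(i < n.*2) H (D i.+1) <= H X + H X)%E.
  rewrite (_ : (\sum_(i < n.*2) H (D i.+1) = \sum_(i < n) H (D (i.*2 + 0)%N.+1) +
      \sum_(i < n) H (D (i.*2 + 1)%N.+1))%E).
    by apply: leeD; apply: le_trans (Dsum _ _) _; exact: le_hausdorff.
  elim: n => [|n ih]; first by rewrite !big_ord0 adde0.
  rewrite doubleS !big_ord_recr/= ih addn0 addn1 -!addeA; congr (_ + _)%E.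
  by rewrite addeCA.
have Dfin : (\sum_(0 <= i <oo) H (D i.+1) < +oo)%E.
  apply: (@le_lt_trans _ _ (H X + H X)%E); last first.
    by rewrite lte_add_pinfty// -ge0_fin_numE ?hausdorff_ge0.
  apply: lime_le; first by apply: is_cvg_nneseries => *; exact: hausdorff_ge0.
  apply: nearW => n; apply: le_trans (Dsum2 n).
  rewrite big_mkord -addnn big_split_ord/= leeDl// sume_ge0// => i _.
  exact: hausdorff_ge0.
(* Closedness enters here: a point outside [F] has positive distance to [F], so it lies in some
   [E N]. *)
have Ecov n : X `&` ~` F `<=` E n.+1 `|` \bigcup_(i in ~` `I_n) D i.+1.
  move=> x [Xx nFx].
  have [N Ex] : exists N, E N x.
    have : nbhs x (~` F) by apply: open_nbhs_nbhs; split => //; exact: closed_openC.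
    move=> /nbhs_ballP[e /= e0 eF].
    have [N _ /(_ N (leqnn N)) Ne] := near_infty_natSinv_lt (PosNum e0).
    exists N; split => // y Fy; rewrite leNgt; apply/negP => xy.
    by apply: (eF y) => //; rewrite -ball_normE/=; exact: lt_trans Ne.
  have [xn|xn] := pselect (E n.+1 x); [by left|right].
  elim: N Ex => [|N ih] Ex; first by case: xn; exact: Ele Ex.
  have [EN|EN] := pselect (E N x); first exact: ih.
  case: N => [|N] in Ex EN {ih} *; first by case: xn; exact: Ele Ex.
  exists N => //=; apply/negP; rewrite -leqNgt leqNgt; apply/negP => Nn.
  by apply: xn; exact: Ele Ex.
apply/lee_addgt0Pr => e e0.
have /fine_cvgP[tfin /cvgrPdist_lt/(_ e e0) te] :=
  nneseries_tail_cvg Dfin (fun k _ => hausdorff_ge0 (D k.+1)).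
have [n [tn en]] : exists n, (\sum_(n <= i <oo) H (D i.+1))%E \is a fin_num /\
    (\sum_(n <= i <oo) H (D i.+1) <= e%:E)%E.
  near \oo => n; exists n.
  have tn : (\sum_(n <= i <oo) H (D i.+1))%E \is a fin_num by near: n.
  split => //; rewrite -[X in (X <= _)%E](fineK tn) lee_fin.
  apply: le_trans (ler_norm _) _; rewrite -normrN -[X in `|X|]add0r ltW//.
  by near: n.
apply: (@le_trans _ _ (H (X `&` F) + (H (E n.+1) + e%:E))%E); last first.
  by rewrite addeA leeD2r.
apply: leeD => //; apply: le_trans (le_hausdorff (Ecov n)) _.
apply: le_trans (outer_measureU2 _ _ _) _; apply: leeD => //.
apply: le_trans en.
exact: (outer_measure_sigma_subadditive_tail H n (fun i => D i.+1)).
Unshelve. all: by end_near. Qed.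

Lemma borel_caratheodory (A : set (borelRd R d)) : measurable A -> H.-caratheodory A.
Proof.
apply: smallest_sub A; last first.
  by move=> A oA; rewrite -(setCK A); apply/caratheodory_measurable_setC;
    apply: closed_caratheodory; exact: open_closedC.
split; first exact: caratheodory_measurable_set0.
- by move=> A cA; rewrite setTD; exact: caratheodory_measurable_setC.
- by move=> F cF; exact: caratheodory_measurable_bigcup.
Qed.

Lemma hausdorff_semi_sigma_additive : semi_sigma_additive H.
Proof.
move=> F mF tF mUF.
by apply: (@caratheodory_measure_sigma_additive _ _ H) => //;
  [move=> i|]; exact: borel_caratheodory.
Qed.

HB.instance Definition _ := isMeasure.Build _ (borelRd R d) R H
  hausdorff0 hausdorff_ge0 hausdorff_semi_sigma_additive.

Lemma closed_borel (A : set (borelRd R d)) : closed (A : set 'rV[R]_d) -> measurable A.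
Proof.
move=> cA; rewrite -(setCK A); apply: measurableC; apply: sub_sigma_algebra.
exact: closed_openC.
Qed.

End hausdorff_measure.

(** * Hausdorff measure of Lipschitz graphs, spheres and hyperplane sections *)

Section hausdorff_graph.
Context {R : realType} {d : nat}.
Implicit Types (U : set 'rV[R]_d.+1).

Lemma diam2_le U (e : R) :
  (forall x y, U x -> U y -> norm2 (x - y) <= e) -> (diam2 U <= e%:E)%E.
Proof.
by move=> Ue; apply: ge_ereal_sup => _ [[x y] [Ux Uy] <-]; rewrite lee_fin Ue.
Qed.

Lemma hausdorff_weight_le k U (e : R) : 0 <= e -> (diam2 U <= e%:E)%E ->
  (hausdorff_weight k U <= (hausdorff_const R k * e ^+ k)%:E)%E.
Proof.
move=> e0 Ue; have hc0 := hausdorff_const_ge0 (R := R) k.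
rewrite /hausdorff_weight; case: ifPn => [_|U0].
  by rewrite lee_fin mulr_ge0// exprn_ge0.
have dU0 := diam2_ge0 U0.
have fU : diam2 U \is a fin_num.
  by rewrite ge0_fin_numE// (le_lt_trans Ue)// ltry.
rewrite -(fineK fU) -EFin_expe -EFinM lee_fin ler_wpM2l// lerXn2r ?nnegrE//.
  by rewrite fine_ge0.
by rewrite -lee_fin fineK.
Qed.

Lemma truncn_dist (x y : R) : 0 <= x -> 0 <= y ->
  Num.truncn x = Num.truncn y -> `|x - y| < 1.
Proof.
move=> /truncn_itv/andP[xl xu] /truncn_itv/andP[yl yu] xy.
rewrite ltr_norml; move: xl xu yl yu; rewrite xy -natr1.
by move=> *; apply/andP; split; lra.
Qed.

(** The set [A] is a Lipschitz graph over the coordinates other than [i0]. Cutting each of these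
    into [n.+1] intervals of length w = 2 rho / n (the last one catches the endpoint) gives (n+1)^d
    cells of diameter at most L w, and (n+1) L w <= 2 n L w = 4 rho L at every scale. *)
Lemma hausdorff_graph (A : set (borelRd R d.+1)) (i0 : 'I_d.+1) (c : 'rV[R]_d.+1)
    (rho L : R) : 0 < rho -> 0 < L ->
  (forall x, A x -> forall i, `|x 0 i - c 0 i| <= rho) ->
  (forall x y e, A x -> A y -> 0 <= e ->
     (forall k : 'I_d, `|x 0 (lift i0 k) - y 0 (lift i0 k)| <= e) ->
     norm2 (x - y) <= L * e) ->
  (hausdorff d A <= (hausdorff_const R d * (4 * rho * L) ^+ d)%:E)%E.
Proof.
move=> rho0 L0 Arho AL; apply: ge_ereal_sup => _ [delta /= d0 <-].
pose n := (Num.truncn (L * (2 * rho) / delta)).+1.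
have n0 : 0 < n%:R :> R by rewrite ltr0n.
pose w := 2 * rho / n%:R.
have w0 : 0 < w by rewrite !mulr_gt0// invr_gt0.
have Lwd : L * w <= delta.
  rewrite /w mulrA ler_pdivrMr// (mulrC delta) -ler_pdivrMr// ltW//.
  by rewrite /n -truncn_le_nat.
pose u (x : 'rV[R]_d.+1) (k : 'I_d) := (x 0 (lift i0 k) - c 0 (lift i0 k) + rho) / w.
have u0 x k : A x -> 0 <= u x k.
  move=> /Arho/(_ (lift i0 k)); rewrite ler_norml => /andP[+ _].
  by move=> h; rewrite divr_ge0 ?(ltW w0)//; lra.
have un x k : A x -> (Num.truncn (u x k) < n.+1)%N.
  move=> Ax; rewrite truncn_lt_nat ?u0//.
  move: (Ax) => /Arho/(_ (lift i0 k)); rewrite ler_norml => /andP[_ h].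
  apply: (@le_lt_trans _ _ n%:R); last by rewrite ltr_nat.
  rewrite /u ler_pdivrMr// /w mulrC divfK ?gt_eqF//; lra.
pose T := {ffun 'I_d -> 'I_n.+1}.
pose cell (b : T) := [set x | A x /\ forall k, Num.truncn (u x k) = b k].
(* The finitely many cells are listed as a sequence, completed by empty sets of weight 0. *)
pose U (i : nat) := if insub i is Some j then cell (@enum_val T predT j) else set0.
have AU : A `<=` \bigcup_i U i.
  move=> x Ax; pose b : T := [ffun k => Ordinal (un x k Ax)].
  exists (@enum_rank T b) => //; rewrite /U.
  case: insubP => [j _ /val_inj ->|]; last by rewrite ltn_ord.
  by rewrite enum_rankK; split => // k; rewrite ffunE.
have cellL b : (diam2 (cell b) <= (L * w)%:E)%E.
  apply: diam2_le => x y [Ax xb] [Ay yb]; apply: AL => //; first exact: ltW.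
  move=> k; have := truncn_dist (u0 x k Ax) (u0 y k Ay).
  rewrite xb yb => /(_ erefl)/ltW; rewrite /u -mulrBl normrM normfV (gtr0_norm w0).
  by rewrite ler_pdivrMr// mul1r; congr (`|_| <= _); ring.
have Lw0 : 0 <= L * w by rewrite ltW// mulr_gt0.
have UL i : (diam2 (U i) <= (L * w)%:E)%E.
  by rewrite /U; case: insubP => // _; rewrite diam20 leNye.
apply: le_trans (hausdorff_pre_le d AU _) _.
  by move=> i; apply: le_trans (UL i) _; rewrite lee_fin.
rewrite (nneseries_split 0 #|T|); last by move=> *; exact: hausdorff_weight_ge0.
rewrite add0n eseries0 ?adde0; last first.
  by move=> i iT _; rewrite /U insubF ?hausdorff_weight0// ltnNge iT.
apply: (@le_trans _ _ (\sum_(0 <= i < #|T|) (hausdorff_const R d * (L * w) ^+ d)%:E)%E).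
  by apply: lee_sum => i _; exact: hausdorff_weight_le.
rewrite sumEFin lee_fin big_const_nat iter_addr_0 subn0 card_ffun !card_ord.
rewrite -[leLHS]mulr_natl mulrCA ler_wpM2l ?hausdorff_const_ge0// natrX -exprMn.
have rho0' := ltW rho0; have L0' := ltW L0; have w0' := ltW w0.
apply: lerXn2r; rewrite ?nnegrE ?mulr_ge0//.
rewrite (_ : 4 * rho * L = 2 * n%:R * (L * w)); last first.
  by rewrite /w; field; rewrite gt_eqF.
by rewrite ler_wpM2r// -natrM ler_nat mul2n -addnn -addn1 leq_add2l.
Qed.

End hausdorff_graph.

Section sphere_and_hyperplanes.
Context {R : realType} {d : nat}.
Implicit Types (v x y c : 'rV[R]_d.+1).

Lemma normr_coord_max v : exists i, `|v 0 i| = `|v|.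
Proof.
have [->|v0] := eqVneq v 0; first by exists 0; rewrite mxE !normr0.
have [[a i]] : exists i, `|v| = `|v i.1 i.2|.
  by apply: mx_norm_neq0; rewrite -[mx_norm v]/(`|v|) normr_eq0.
by rewrite (ord1 a) => ->; exists i.
Qed.

Lemma unit_big_coord v : norm2 v = 1 -> exists i, 1 <= d.+1%:R * `|v 0 i|.
Proof.
move=> v1; have [i vi] := normr_coord_max v; exists i; rewrite vi -[leLHS]v1.
by apply: norm2_le => // j; exact: normr_coord.
Qed.

Lemma unit_coord v i : norm2 v = 1 -> `|v 0 i| <= 1.
Proof. by move=> <-; exact: coord_le_norm2. Qed.

Lemma norm2_le_graph v (i0 : 'I_d.+1) (e : R) : 0 <= e ->
  (forall k : 'I_d, `|v 0 (lift i0 k)| <= e) ->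
  `|v 0 i0| <= d.+1%:R ^+ 2 * e -> norm2 v <= d.+1%:R ^+ 3 * e.
Proof.
move=> e0 ve vi0; rewrite exprS -mulrA; apply: norm2_le.
  by rewrite mulr_ge0// exprn_ge0.
move=> i; case: (unliftP i0 i) => [k ->|->//].
apply: le_trans (ve k) _; rewrite ler_peMl// -natrX ler1n.
by rewrite expn_gt0.
Qed.

(** Used with [s] equal to 1 or -1. On such a cap coordinate [i] has a fixed sign and stays away
    from 0, so the sphere is a Lipschitz graph over the other coordinates. *)
Definition sphere_cap (i : 'I_d.+1) (s : R) : set (borelRd R d.+1) :=
  [set v | norm2 v = 1 /\ 1 <= d.+1%:R * (s * v 0 i)].

(** Subtracting the equations of two points of the sphere expresses (x_i - y_i)(x_i + y_i) through
    the other coordinates, and on the cap x_i + y_i is at least 2 / (d+1) in absolute value. *)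
Lemma hausdorff_sphere_cap i (s : R) : `|s| = 1 ->
  (hausdorff d (sphere_cap i s) < +oo)%E.
Proof.
move=> s1; apply: le_lt_trans (@hausdorff_graph _ _ _ i 0 1 (d.+1%:R ^+ 3) _ _ _ _) (ltry _) => //.
- by move=> x [x1 _] j; rewrite mxE subr0; exact: unit_coord.
- move=> x y e [x1 xi] [y1 yi] e0 xy; apply: (@norm2_le_graph _ i) => //.
    by move=> k; rewrite !mxE.
  have d0 : 0 < d.+1%:R :> R by [].
  have xyi : `|x 0 i - y 0 i| * `|x 0 i + y 0 i| <= 2 * d.+1%:R * e.
    rewrite -normrM.
    have : dotv x x = dotv y y by rewrite -!norm2_sqr x1 y1.
    rewrite /dotv (bigD1_ord i)//= [in RHS](bigD1_ord i)//= => sxy.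
    have -> : (x 0 i - y 0 i) * (x 0 i + y 0 i) = \sum_(k < d)
        (y 0 (lift i k) - x 0 (lift i k)) * (y 0 (lift i k) + x 0 (lift i k)).
      transitivity (\sum_(k < d) y 0 (lift i k) * y 0 (lift i k) -
                    \sum_(k < d) x 0 (lift i k) * x 0 (lift i k)).
        by move: sxy; set p := bigop _ _ _; set q := bigop _ _ _ => ?; lra.
      by rewrite -sumrB; apply: eq_bigr => k _; ring.
    apply: le_trans (ler_norm_sum _ _ _) _.
    apply: (@le_trans _ _ (\sum_(k < d) e * 2)).
      apply: ler_sum => k _; rewrite normrM.
      apply: ler_pM; [exact: normr_ge0|exact: normr_ge0|by rewrite distrC; exact: xy|].
      apply: le_trans (ler_normD _ _) _.
      by have := unit_coord (lift i k) x1; have := unit_coord (lift i k) y1; lra.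
    rewrite sumr_const card_ord -[leLHS]mulr_natl -natr1.
    have : 0 <= d%:R :> R by [].
    by move=> dd; nra.
  have xyi2 : 2 <= d.+1%:R * `|x 0 i + y 0 i|.
    have -> : `|x 0 i + y 0 i| = `|s * x 0 i + s * y 0 i|.
      by rewrite -mulrDr normrM s1 mul1r.
    have := ler_wpM2l (ltW d0) (ler_norm (s * x 0 i + s * y 0 i)).
    by move: xi yi; lra.
  rewrite !mxE.
  have := ler_wpM2l (normr_ge0 (x 0 i - y 0 i)) xyi2.
  by have := ler_wpM2l (ltW d0) xyi; rewrite expr2 => h1 h2; lra.
Qed.

Lemma sphere_closed : closed [set v : 'rV[R]_d.+1 | norm2 v = 1].
Proof.
rewrite (_ : [set _ | _] = (fun v => dotv v v) @^-1` [set 1]).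
  apply: preimage_closed => [v _|]; last exact: closed_eq.
  apply: (@cvg_sumr _ _ _ (nbhs v) (nbhs_filter v)) => i.
  by apply: (@cvgM _ _ (nbhs v) (nbhs_filter v)); exact: coord_continuous.
apply/seteqP; split=> v /=; first by rewrite -norm2_sqr => ->; rewrite expr1n.
by rewrite /norm2 => ->; rewrite sqrtr1.
Qed.

Lemma hausdorff_sphere : (hausdorff d (@sphere R d.+1) < +oo)%E.
Proof.
(* The integer [n] encodes a coordinate [n./2] and, by its parity, a sign. *)
pose F (n : nat) : set (borelRd R d.+1) := sphere_cap (inord n./2) ((-1) ^+ odd n).
apply: (@le_lt_trans _ _ (hausdorff d (\big[setU/set0]_(n < d.+1.*2) F n))).
  apply: le_hausdorff => v v1.
  have [i vi] := unit_big_coord v1; rewrite -bigcup_mkord.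
  exists ((v 0 i < 0)%R + i.*2)%N => /=.
    by have := ltn_ord i; case: (v 0 i < 0) => /=; lia.
  split => //; rewrite half_bit_double oddD odd_double addbF.
  by rewrite inord_val oddb -normrEsign.
apply: le_lt_trans (outer_measure_subadditive (hausdorff d) F _) _.
apply: lte_sum_pinfty => n _; apply: hausdorff_sphere_cap.
by rewrite normrX normrN1 expr1n.
Qed.

Lemma perp_closed v : closed (perp v : set 'rV[R]_d.+1).
Proof.
apply: (@preimage_closed _ _ (fun y : 'rV[R]_d.+1 => dotv y v) [set t | t = 0]).
  by move=> y _; exact: dotv_continuous.
exact: closed_eq.
Qed.

Definition box c (rho : R) : set (borelRd R d.+1) :=
  [set y | forall i, `|y 0 i - c 0 i| <= rho].

Lemma box_closed c rho : closed (box c rho : set 'rV[R]_d.+1).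
Proof.
rewrite (_ : box c rho = \bigcap_i ((fun y : 'rV[R]_d.+1 => `|y 0 i - c 0 i|) @^-1` [set t | t <= rho])).
  apply: closed_bigI => i _.
  apply: (@preimage_closed _ _ (fun y : 'rV[R]_d.+1 => `|y 0 i - c 0 i|) [set t | t <= rho]).
    move=> y _; apply: (@cvg_norm _ _ _ (nbhs y) (nbhs_filter y)).
    apply: (@cvgB _ _ _ (nbhs y) (nbhs_filter y)); first exact: coord_continuous.
    exact: cvg_cst.
  exact: closed_le.
by apply/seteqP; split=> [y yb i _|y yb i]; apply: yb.
Qed.

(** The equation of the hyperplane is solved for a coordinate in which the unit vector [v] is at
    least 1 / (d+1). The resulting bound is uniform in [v] and [c], hence the later uniformity in
    the direction. *)
Lemma hausdorff_perp_box v c rho : norm2 v = 1 -> 0 < rho ->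
  (hausdorff d (perp v `&` box c rho) <=
     (hausdorff_const R d * (4 * d.+1%:R ^+ 3) ^+ d * rho ^+ d)%:E)%E.
Proof.
move=> v1 rho0; have [i vi] := unit_big_coord v1.
rewrite -mulrA -exprMn (mulrAC 4).
apply: (@hausdorff_graph _ _ _ i c) => //.
- by move=> x [].
- move=> x y e [xv _] [yv _] e0 xy; apply: (@norm2_le_graph _ i) => //.
    by move=> k; rewrite !mxE.
  have d0 : 0 < d.+1%:R :> R by [].
  have h1 : `|x 0 i - y 0 i| * `|v 0 i| <= d.+1%:R * e.
    rewrite -normrM.
    have -> : (x 0 i - y 0 i) * v 0 i = - \sum_(k < d)
        (x 0 (lift i k) - y 0 (lift i k)) * v 0 (lift i k).
      move: xv yv; rewrite /perp/= /dotv (bigD1_ord i)//= => /eqP.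
      rewrite addr_eq0 => /eqP xv; rewrite (bigD1_ord i)//= => /eqP.
      rewrite addr_eq0 => /eqP yv; rewrite mulrBl xv yv -opprD -sumrB.
      by congr (- _); apply: eq_bigr => k _; rewrite mulrBl.
    rewrite normrN; apply: le_trans (ler_norm_sum _ _ _) _.
    apply: (@le_trans _ _ (\sum_(k < d) e * 1)).
      apply: ler_sum => k _; rewrite normrM.
      by apply: ler_pM; [exact: normr_ge0|exact: normr_ge0|exact: xy|exact: unit_coord].
    rewrite sumr_const card_ord mulr1 -[leLHS]mulr_natl -natr1 mulrDl mul1r.
    by rewrite lerDl.
  rewrite !mxE.
  have := ler_wpM2l (normr_ge0 (x 0 i - y 0 i)) vi.
  have := ler_wpM2l (ltW d0) h1; rewrite expr2 mulr1 => h3 h2; lra.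
Qed.

End sphere_and_hyperplanes.

(** * Zeros on a line and derivatives *)

Section one_variable.
Context {R : realType}.
Implicit Types (g : R -> R) (a b : R).

Lemma mvt_unordered g (dg : R -> R) a b : (forall x : R, is_derive x 1 g (dg x)) ->
  exists2 c, Num.min a b <= c <= Num.max a b & g b - g a = dg c * (b - a).
Proof.
move=> gdg.
have cg x : {for x, continuous g}.
  by apply: differentiable_continuous; apply/derivable1_diffP; case: (gdg x).
have [ab|/ltW ba] := leP a b.
- have [c] := @MVT_segment _ g dg a b ab (fun x _ => gdg x)
    (continuous_subspaceT cg).
  by rewrite in_itv/= => cab gE; exists c.
- have [c] := @MVT_segment _ g dg b a ba (fun x _ => gdg x)
    (continuous_subspaceT cg).
  by rewrite in_itv/= => cab gE; exists c => //; rewrite -opprB gE -mulrN opprB.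
Qed.

(** The conclusion also locates the new zeros, after [z] and not beyond the last old zero, so that
    the iteration stays in the same interval. *)
Lemma rolle_path g (dg : R -> R) (z : R) (Z : seq R) :
  (forall x : R, is_derive x 1 g (dg x)) -> path <%R z Z -> all (fun t => g t == 0) (z :: Z) ->
  exists Z', [/\ path <%R z Z', size Z' = size Z, all (fun t => dg t == 0) Z' &
    all (fun t => t <= last z Z) Z'].
Proof.
move=> gdg; elim: Z z => [|z' Z ih] z; first by exists [::].
move=> /= /andP[zz' pZ] /and3P[/eqP gz /eqP gz' gZ].
have [|Z' [pZ' sZ' dZ' lZ']] := ih z' pZ; first by rewrite /= gz' eqxx.
have cg x : {for x, continuous g}.
  by apply: differentiable_continuous; apply/derivable1_diffP; case: (gdg x).
have [c] := @MVT _ g dg z z' zz' (fun x _ => gdg x) (continuous_subspaceT cg).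
rewrite in_itv/= gz gz' subrr => /andP[zc cz'] /esym/eqP.
rewrite mulf_eq0 subr_eq0 (gt_eqF zz') orbF => dgc.
have lez' : z' <= last z' Z.
  have := mem_last z' Z; rewrite inE => /predU1P[->//|].
  by move=> /(allP (order_path_min lt_trans pZ))/ltW.
exists (c :: Z'); split => /=.
- rewrite zc/=; case: (Z') pZ' => //= w W /andP[z'w ->].
  by rewrite (lt_trans cz' z'w).
- by rewrite sZ'.
- by rewrite dgc.
- by rewrite lZ' (le_trans (ltW cz')).
Qed.

(** Each differentiation loses one zero but keeps a zero of the current function; the mean value
    theorem from that zero to [t] yields one factor [b - a]. *)
Lemma rolle_iterated (k : nat) (g : nat -> R -> R) a b (M : R) (Z : seq R) :
  (forall j (x : R), is_derive x 1 (g j) (g j.+1 x)) ->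
  sorted <%R Z -> size Z = k -> all (fun t => g 0%N t == 0) Z ->
  all (fun t => a <= t <= b) Z ->
  (forall t, a <= t <= b -> `|g k t| <= M) ->
  forall t, a <= t <= b -> `|g 0%N t| <= (b - a) ^+ k * M.
Proof.
move=> + + + + + + t tab.
have ab : a <= b by case/andP: tab; exact: le_trans.
elim: k g Z t tab => [|k ih] g Z t tab gdg sZ kZ gZ Zab gM.
  by rewrite expr0 mul1r; exact: gM.
case: Z => [//|z Z] in sZ kZ gZ Zab; case: kZ => kZ.
have [Z' [pZ' sZ' dZ' lZ']] := rolle_path (gdg 0%N) sZ gZ.
have zab : a <= z <= b by case/andP: Zab.
have lab : last z Z <= b.
  by have /andP[] := allP Zab _ (mem_last z Z).
have [c cb ->] : exists2 c, a <= c <= b & g 0%N t = g 1%N c * (t - z).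
  have [c /andP[c1 c2] gE] := mvt_unordered z t (gdg 0%N).
  case/andP: gZ => /eqP gz _; rewrite gz subr0 in gE.
  exists c => //; case/andP: zab => az zb; case/andP: tab => at_ tb.
  rewrite (le_trans _ c1) ?le_min ?az//= (le_trans c2)// ge_max zb.
  by rewrite tb.
rewrite normrM exprSr mulrAC; apply: ler_pM => //.
- apply: (ih (fun j => g j.+1) Z') => //.
  + exact: path_sorted pZ'.
  + by rewrite sZ'.
  + apply/allP => w wZ'; case/andP: zab => az zb.
    rewrite (le_trans az) ?(le_trans (allP lZ' _ wZ'))//.
    by rewrite ltW// (allP (order_path_min lt_trans pZ')).
- by case/andP: zab => ? ?; case/andP: tab => ? ?; rewrite ler_norml; apply/andP; split; lra.
Qed.

End one_variable.

(** * Iterated partial derivatives and derivatives along lines *)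

Section partial_derivatives.
Context {R : realType} {d : nat}.
Implicit Types (f : 'rV[R]_d -> R) (v x y : 'rV[R]_d) (s : seq 'I_d) (i : 'I_d).

Local Notation e i := (delta_mx 0 i : 'rV[R]_d).

Definition pd s f : 'rV[R]_d -> R := foldr (fun i g x => 'D_(e i) g x) f s.

Lemma smooth_derive f i : smooth f -> smooth (fun x => 'D_(e i) f x).
Proof. by move=> sf k; have /= [_ /(_ i)[]] := sf k.+1. Qed.

Lemma smooth_pd s f : smooth f -> smooth (pd s f).
Proof. by move=> sf; elim: s => //= i s; exact: smooth_derive. Qed.

Lemma smooth_continuous f : smooth f -> continuous f.
Proof. by move=> /(_ 0%N). Qed.

Lemma smooth_is_derive f x i : smooth f -> is_derive x (e i) f ('D_(e i) f x).
Proof. by move=> /(_ 1%N)/= [_ /(_ i)[/(_ x) dx _]]; exact/derivableP. Qed.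

Lemma smooth_coord_derive f x i (t : R) : smooth f ->
  is_derive t 1 (fun t => f (x + t *: e i)) ('D_(e i) f (x + t *: e i)).
Proof.
move=> sf; have [df dE] := smooth_is_derive (x + t *: e i) i sf.
have E : (fun h => h^-1 *: (((fun t => f (x + t *: e i)) \o shift t) (h *: 1) -
    f (x + t *: e i))) = (fun h => h^-1 *: ((f \o shift (x + t *: e i)) (h *: e i) -
    f (x + t *: e i))).
  apply/funext => h /=; congr (_ *: (f _ - _)).
  by rewrite [h *: 1]mulr1 scalerDl addrCA.
by split; [rewrite /derivable E|rewrite /derive E].
Qed.

(** The chain rule from continuous partial derivatives: the increment is telescoped over the
    coordinates, the mean value theorem is applied to each term, and the intermediate points tend to
    [x]. *)
Lemma smooth_line_derive f y v (t : R) : smooth f ->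
  is_derive t 1 (fun t => f (y + t *: v))
    (\sum_(i < d) v 0 i * 'D_(e i) f (y + t *: v)).
Proof.
move=> sf; set x := y + t *: v.
(* The first [m] coordinates of [v], followed by zeros. *)
pose w (m : nat) : 'rV[R]_d := \row_i (if (i < m)%N then v 0 i else 0).
have wS (m : 'I_d) : w m.+1 = w m + v 0 m *: e m.
  apply/rowP => j; rewrite !mxE ltnS leq_eqVlt eqxx/=.
  have [->|mj] := eqVneq j m; first by rewrite eqxx ltnn add0r mulr1.
  by rewrite (negbTE (mj : val j != val m)) mulr0 addr0.
have stepE (h : R) (m : 'I_d) : exists xi : R, `|xi| <= `|h * v 0 m| /\
    h^-1 *: (f (x + h *: w m.+1) - f (x + h *: w m)) =
    h^-1 * h * (v 0 m * 'D_(e m) f (x + h *: w m + xi *: e m)).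
  have [c /andP[c1 c2] cE] := @mvt_unordered _ _ _ 0 (h * v 0 m)
    (fun t => smooth_coord_derive (x + h *: w m) m t sf).
  exists c; split.
    by move: c1 c2; case: (leP 0 (h * v 0 m)) => h0 c1 c2;
      [rewrite !ger0_norm|rewrite !ler0_norm//; lra] => //; exact: ltW.
  rewrite wS [h *: (w m + _)]scalerDr addrA scalerA.
  rewrite scale0r addr0 subr0 in cE; rewrite cE /GRing.scale/=; ring.
have step (m : 'I_d) :
    h^-1 *: (f (x + h *: w m.+1) - f (x + h *: w m)) @[h --> 0^'] -->
    v 0 m * 'D_(e m) f x.
  have [xi xiP] := choice (stepE ^~ m).
  apply: (@cvg_trans _ (v 0 m * 'D_(e m) f (x + h *: w m + xi h *: e m) @[h --> 0^'])).
    apply: near_eq_cvg; near=> h.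
    rewrite (xiP h).2 mulVf ?mul1r//.
    by near: h; exact: nbhs_dnbhs_neq.
  apply: cvgM; first exact: cvg_cst.
  have cD := smooth_continuous (smooth_derive m sf).
  apply: (cvg_comp (fun h => x + h *: w m + xi h *: e m)
    (fun z => 'D_(e m) f z)); last exact: cD.
  have h0 : h @[h --> (0:R)^'] --> (0:R) by exact: cvg_within.
  have xi0 : xi h @[h --> 0^'] --> 0.
    apply/cvgr0Pnorm_le => eps eps0.
    have : h * v 0 m @[h --> 0^'] --> 0 by rewrite -[X in _ --> X](mul0r (v 0 m)); apply: cvgMr_tmp.
    move=> /cvgr0Pnorm_le/(_ _ eps0); apply: filterS => h; apply: le_trans.
    exact: (xiP h).1.
  suff : x + h *: w m + xi h *: e m @[h --> 0^'] --> x + 0 + 0 by rewrite !addr0.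
  apply: cvgD; first apply: cvgD.
  - exact: cvg_cst.
  - by rewrite -(scale0r (w m)); apply: cvgZr_tmp.
  - by rewrite -(scale0r (e m)); apply: cvgZr_tmp.
have lim : h^-1 *: (((fun t => f (y + t *: v)) \o shift t) (h *: 1) - f x)
    @[h --> (0:R)^'] --> \sum_(i < d) v 0 i * 'D_(e i) f x.
  have E (h : R) : h^-1 *: (((fun t => f (y + t *: v)) \o shift t) (h *: 1) - f x) =
      \sum_(m < d) h^-1 *: (f (x + h *: w m.+1) - f (x + h *: w m)).
    rewrite -scaler_sumr -(big_mkord xpredT (fun m => f (x + h *: w m.+1) - f (x + h *: w m))).
    rewrite telescope_sumr// /=; congr (_ *: (f _ - f _)).
      rewrite [h *: 1]mulr1 scalerDl addrCA addrC; congr (_ + _ *: _).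
      by apply/rowP => j; rewrite mxE ltn_ord.
    rewrite (_ : w 0%N = 0) ?scaler0 ?addr0//.
    by apply/rowP => j; rewrite !mxE ltn0.
  by under eq_fun do rewrite E; apply: cvg_sumr => m; exact: step.
by split; [apply/cvg_ex; eexists; exact: lim|exact: cvg_lim lim].
Unshelve. all: by end_near. Qed.

End partial_derivatives.

Section directional_derivatives.
Context {R : realType} {d : nat}.
Implicit Types (f g : 'rV[R]_d -> R) (v x y z : 'rV[R]_d) (r M : R).

Local Notation e i := (delta_mx 0 i : 'rV[R]_d).

Lemma continuous_ball_bounded g r : continuous g ->
  exists2 M, 0 <= M & forall x, `|x| <= r -> `|g x| <= M.
Proof.
move=> cg; have cB : compact [set x : 'rV[R]_d | `|x| <= r].
  apply: bounded_closed_compact; last first.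
    by apply: (@preimage_closed _ _ (fun x : 'rV[R]_d => `|x|) [set t | t <= r]) => [x _|];
      [exact: norm_continuous|exact: closed_le].
  by exists r; split; [exact: num_real|move=> M rM x /= xr; exact: ltW (le_lt_trans xr rM)].
have /compact_bounded[M [Mreal MB]] := continuous_compact (continuous_subspaceT cg) cB.
exists (`|M| + 1) => [|x xr]; first by rewrite addr_ge0.
by apply: (MB (`|M| + 1)); [rewrite ltr_pwDr// ler_norm|exists x].
Qed.

Lemma segment_ball x y r (c : R) : `|x| <= r -> `|y| <= r -> 0 <= c <= 1 ->
  `|y + c *: (x - y)| <= r.
Proof.
move=> xr yr /andP[c0 c1].
have -> : y + c *: (x - y) = c *: x + (1 - c) *: y.
  by rewrite scalerBr scalerBl scale1r addrCA.
apply: le_trans (ler_normD _ _) _; rewrite !normrZ.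
rewrite (ger0_norm c0) ger0_norm ?subr_ge0//.
by have := ler_wpM2l c0 xr; have := @ler_wpM2l _ (1 - c) _ _ _ yr; rewrite subr_ge0 => /(_ c1); lra.
Qed.

Lemma smooth_lipschitz_bound f r M : smooth f ->
  (forall i z, `|z| <= r -> `|'D_(e i) f z| <= M) ->
  forall x y, `|x| <= r -> `|y| <= r -> `|f x - f y| <= d%:R * M * `|x - y|.
Proof.
move=> sf fM x y xr yr.
have [c] := mvt_unordered 0 1 (fun t => smooth_line_derive y (x - y) t sf).
rewrite scale1r scale0r addr0 subr0 mulr1 [y + (x - y)]addrC subrK.
rewrite (min_l ler01) (max_r ler01).
move=> c01 ->; apply: le_trans (ler_norm_sum _ _ _) _.
apply: (@le_trans _ _ (\sum_(i < d) M * `|x - y|)); last first.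
  by rewrite sumr_const card_ord -mulrA [leRHS]mulr_natl.
apply: ler_sum => i _; rewrite normrM mulrC ler_pM ?normr_coord//.
by apply: fM; exact: segment_ball.
Qed.

Lemma smooth_lipschitz f r : smooth f ->
  exists2 L, 0 <= L & forall x y, `|x| <= r -> `|y| <= r -> `|f x - f y| <= L * `|x - y|.
Proof.
move=> sf.
have B (i : 'I_d) : exists M, 0 <= M /\ forall z, `|z| <= r -> `|'D_(e i) f z| <= M.
  by have [M] := continuous_ball_bounded r (smooth_continuous (smooth_derive i sf)); exists M.
have [M MB] := choice B.
exists (d%:R * \sum_i M i).
  by rewrite mulr_ge0// sumr_ge0// => i _; case: (MB i).
apply: smooth_lipschitz_bound => // i z zr; apply: le_trans ((MB i).2 z zr) _.
by rewrite (bigD1 i)//= lerDl sumr_ge0// => j _; case: (MB j).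
Qed.

(* The [k]-th derivative of [f] in the direction [v] as a list of pairs: a
   coefficient and the directions of an iterated partial derivative. *)
Definition dir_terms v (k : nat) : seq (R * seq 'I_d) :=
  iter k (fun l => [seq (c.1 * v 0 i, i :: c.2) | c <- l, i <- enum 'I_d]) [:: (1, [::])].

Definition dir_pd v (k : nat) f x := \sum_(c <- dir_terms v k) c.1 * pd c.2 f x.

Lemma dir_terms_size v k c : c \in dir_terms v k -> size c.2 = k.
Proof.
elim: k c => [|k ih] c /=; first by rewrite inE => /eqP->.
by move=> /allpairsP[[b i] [/= /ih bk _ ->]] /=; rewrite bk.
Qed.

Lemma dir_terms_norm v k : (forall i, `|v 0 i| <= 1) ->
  \sum_(c <- dir_terms v k) `|c.1| <= d%:R ^+ k.
Proof.
move=> v1; elim: k => [|k ih] /=; first by rewrite big_seq1 normr1 expr0.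
rewrite big_allpairs_dep/= exprSr.
apply: (@le_trans _ _ (\sum_(c <- dir_terms v k) `|c.1| * d%:R)); last first.
  by rewrite -mulr_suml ler_wpM2r.
apply: ler_sum => c _; rewrite big_enum/=.
apply: (@le_trans _ _ (\sum_(i < d) `|c.1|)).
  by apply: ler_sum => i _; rewrite normrM ler_piMr.
by rewrite sumr_const card_ord mulr_natr.
Qed.

Lemma dir_pd0 v f x : dir_pd v 0 f x = f x.
Proof. by rewrite /dir_pd big_seq1 mul1r. Qed.

Lemma is_derive_dir_pd f y v k (t : R) : smooth f ->
  is_derive t 1 (fun t => dir_pd v k f (y + t *: v)) (dir_pd v k.+1 f (y + t *: v)).
Proof.
move=> sf; rewrite /dir_pd /= big_allpairs_dep/=.
under [X in is_derive _ _ _ X]eq_bigr do rewrite big_enum/=.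
elim: (dir_terms v k) => [|c l ih].
  rewrite big_nil; under [X in is_derive _ _ X]eq_fun do rewrite big_nil.
  exact: is_derive_cst.
rewrite big_cons; under [X in is_derive _ _ X]eq_fun do rewrite big_cons.
apply: is_deriveD => //.
have -> : \sum_i c.1 * v 0 i * 'D_(e i) (pd c.2 f) (y + t *: v) =
    c.1 *: \sum_i v 0 i * 'D_(e i) (pd c.2 f) (y + t *: v).
  by rewrite [RHS]mulr_sumr; apply: eq_bigr => i _; rewrite mulrA.
apply: is_deriveZ.
exact: smooth_line_derive (smooth_pd _ sf).
Qed.

Lemma dir_pd_le f v k x M : (forall i, `|v 0 i| <= 1) -> 0 <= M ->
  (forall s, size s = k -> `|pd s f x| <= M) -> `|dir_pd v k f x| <= d%:R ^+ k * M.
Proof.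
move=> v1 M0 fM; apply: le_trans (ler_norm_sum _ _ _) _.
apply: (@le_trans _ _ (\sum_(c <- dir_terms v k) `|c.1| * M)).
  rewrite big_seq [leRHS]big_seq; apply: ler_sum => c cv.
  by rewrite normrM ler_wpM2l// fM// (dir_terms_size cv).
by rewrite -mulr_suml ler_wpM2r// dir_terms_norm.
Qed.

Lemma line_zeros_small f y v (u a b M : R) (k : nat) (Z : seq R) :
  smooth f -> (forall i, `|v 0 i| <= 1) -> (0 < k)%N -> 0 <= M ->
  sorted <%R Z -> size Z = k -> all (fun t => f (y + t *: v) == u) Z ->
  all (fun t => a <= t <= b) Z ->
  (forall s t, size s = k -> a <= t <= b -> `|pd s f (y + t *: v)| <= M) ->
  forall t, a <= t <= b -> `|f (y + t *: v) - u| <= (b - a) ^+ k * (d%:R ^+ k * M).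
Proof.
move=> sf v1 k0 M0 sZ kZ fZ Zab fM t tab.
(* The level [u] is subtracted at order 0 only, since it disappears on differentiation. *)
pose g (j : nat) t := dir_pd v j f (y + t *: v) - (if j == 0%N then u else 0).
rewrite (_ : f _ - u = g 0%N t); last by rewrite /g dir_pd0.
apply: (@rolle_iterated _ k g a b _ Z) => //.
- move=> j x; rewrite /g [in X in is_derive _ _ _ X]/= subr0.
  rewrite -[X in is_derive _ _ _ X]subr0; apply: is_deriveB.
  exact: is_derive_dir_pd.
- by apply: sub_all fZ => z /eqP fz; rewrite /g dir_pd0 fz subrr.
- move=> z zab; rewrite /g eqn0Ngt k0/= subr0; apply: dir_pd_le => // s sk.
  exact: fM.
Qed.

End directional_derivatives.

(** * Gaussian tails *)

Section measurable_comparison.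
Context d (T : measurableType d) (R : realType).
Implicit Types (f g : T -> R).

Lemma measurable_set_ltr f g : measurable_fun setT f -> measurable_fun setT g ->
  measurable [set x | f x < g x].
Proof.
move=> mf mg; rewrite -[X in measurable X]setTI.
exact: (measurable_fun_ltr mf mg measurableT (Y := [set true]) I).
Qed.

Lemma measurable_set_ler f g : measurable_fun setT f -> measurable_fun setT g ->
  measurable [set x | f x <= g x].
Proof.
move=> mf mg; rewrite -[X in measurable X]setTI.
exact: (measurable_fun_ler mf mg measurableT (Y := [set true]) I).
Qed.

End measurable_comparison.

Section normal_law.
Context {R : realType}.
Implicit Types (m s t u x : R).

(* Comparing with the density of twice the standard deviation turns the tail
   estimate into the statement that the latter density has mass 1. *)
Lemma normal_pdf_double m s x : s != 0 ->
  normal_pdf m s x = 2 * expR (- (3 / 8 * ((x - m) / s) ^+ 2)) * normal_pdf m (2 * s) x.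
Proof.
move=> s0; have s20 : 2 * s != 0 by rewrite mulf_neq0.
rewrite !normal_pdfE// /normal_peak /normal_fun.
have -> : (2 * s) ^+ 2 * pi *+ 2 = 2 ^+ 2 * (s ^+ 2 * pi *+ 2) by ring.
rewrite sqrtrM ?sqr_ge0// sqrtr_sqr ger0_norm// invfM.
rewrite [RHS](_ : _ = (Num.sqrt (s ^+ 2 * pi *+ 2))^-1 *
  (expR (- (3 / 8 * ((x - m) / s) ^+ 2)) * expR (- (x - m) ^+ 2 / ((2 * s) ^+ 2 *+ 2)))).
  by rewrite -expRD; congr (_ * expR _); field.
by set p := (Num.sqrt _)^-1; field.
Qed.

Lemma normal_prob_far m s t : s != 0 -> 0 < t ->
  (normal_prob m s [set x | (t * `|s| < `|x - m|)%R] <=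
     (2 * expR (- (3 / 8 * t ^+ 2)))%:E)%E.
Proof.
move=> s0 t0; set A := [set x | _].
have mA : measurable A.
  apply: measurable_set_ltr => //; apply: measurableT_comp => //.
  exact: measurable_funB.
set c := 2 * _.
have c0 : 0 <= c by rewrite mulr_ge0// expR_ge0.
have s20 : 2 * s != 0 by rewrite mulf_neq0.
apply: (@le_trans _ _ (c%:E * normal_prob m (2 * s) A)%E); last first.
  rewrite -[leRHS]mule1 lee_wpmul2l ?lee_fin//; exact: probability_le1.
rewrite /normal_prob -ge0_integralZl_EFin//; last 2 first.
- by move=> x _; rewrite lee_fin normal_pdf_ge0.
- by apply/measurable_EFinP/measurable_funTS; exact: measurable_normal_pdf.
apply: ge0_le_integral => //.
- by move=> x _; rewrite lee_fin normal_pdf_ge0.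
- by apply/measurable_EFinP/measurable_funTS; exact: measurable_normal_pdf.
- apply/measurable_EFinP/measurable_funTS; apply: measurable_funM => //.
  exact: measurable_normal_pdf.
move=> x /= tx; rewrite -EFinM lee_fin normal_pdf_double// ler_wpM2r ?normal_pdf_ge0//.
rewrite ler_wpM2l// ler_expR lerN2 ler_wpM2l// -[leRHS]real_normK ?num_real//.
rewrite lerXn2r ?nnegrE ?normr_ge0 ?ltW// normrM normfV ltr_pdivlMr ?normr_gt0//.
Qed.

Lemma expRN_le_pow (q : nat) (y : R) : 0 < y -> expR (- y) <= q`!%:R / y ^+ q.
Proof.
move=> y0; rewrite expRN -[leRHS]invrK lef_pV2 ?posrE ?expR_gt0//; last first.
  by rewrite invr_gt0 divr_gt0 ?exprn_gt0// ltr0n fact_gt0.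
rewrite invf_div; case: q => [|q].
  by rewrite fact0 expr0 divr1 -expR0 ler_expR ltW.
by apply: le_trans (expR_ge1Dxn q (ltW y0)); rewrite lerDr.
Qed.

Lemma normal_prob_tail (q : nat) m s t : s != 0 -> 0 < t ->
  (normal_prob m s [set x | (t * `|s| < `|x - m|)%R] <=
     (2 * q`!%:R * 3 ^+ q / (t ^+ 2) ^+ q)%:E)%E.
Proof.
move=> s0 t0; apply: le_trans (normal_prob_far m s0 t0) _; rewrite lee_fin.
have t20 : 0 < 3 / 8 * t ^+ 2 by rewrite mulr_gt0// exprn_gt0.
rewrite -[leRHS]mulrA -[leRHS]mulrA ler_wpM2l//; apply: le_trans (expRN_le_pow q t20) _.
rewrite ler_wpM2l// -exprVn -[in leRHS]exprVn -exprMn lerXn2r ?nnegrE//.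
- by rewrite invr_ge0 ltW.
- by rewrite mulr_ge0// invr_ge0 sqr_ge0.
- by rewrite invfM ler_wpM2r ?invr_ge0 ?sqr_ge0// invf_div ler_pdivrMr//; lra.
Qed.

Lemma normal_prob_ball m s u (e : R) : s != 0 -> 0 <= e ->
  (normal_prob m s [set x | (`|x - u| <= e)%R] <= (2 * e / `|s|)%:E)%E.
Proof.
move=> s0 e0.
pose I := `[u - e, u + e]%classic.
rewrite (_ : [set x | _] = I); last first.
  by apply/seteqP; split=> x; rewrite /I/= in_itv/= ler_distl.
apply: (@le_trans _ _ (\int[lebesgue_measure]_(x in I) (`|s|^-1)%:E)%E).
  apply: ge0_le_integral => //.
  - exact: measurable_itv.
  - by move=> x _; rewrite lee_fin normal_pdf_ge0.
  - by apply/measurable_EFinP/measurable_funTS; exact: measurable_normal_pdf.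
  - move=> x _; rewrite lee_fin; apply: le_trans (normal_pdf_ub m x s0) _.
    rewrite /normal_peak lef_pV2 ?posrE ?normr_gt0// ?sqrtr_gt0.
      rewrite -[leLHS]sqrtr_sqr ler_wsqrtr// -mulrnAr ler_peMr ?sqr_ge0//.
      by have := pi_ge2 R; rewrite mulr2n; lra.
    by rewrite mulrn_wgt0// mulr_gt0 ?pi_gt0// exprn_even_gt0.
rewrite integral_cst; last exact: measurable_itv.
rewrite /= lebesgue_measure_itv/= lte_fin.
case: ifPn => ue; last by rewrite mule0 lee_fin !mulr_ge0// invr_ge0.
rewrite -EFinB -EFinM lee_fin mulrC ler_wpM2r ?invr_ge0//; lra.
Qed.

End normal_law.

Lemma nneseries_geometric_le {R : realType} (f : nat -> \bar R) (a z : R) :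
  0 <= a -> 0 < z -> z < 1 -> (forall j, 0 <= f j)%E ->
  (forall j, (f j <= (a * z ^+ j)%:E)%E) ->
  (\sum_(0 <= j <oo) f j <= (a * (1 - z)^-1)%:E)%E.
Proof.
move=> a0 z0 z1 f0 fa; apply: lime_le; first by apply: is_cvg_nneseries => *.
apply: nearW => n; apply: (@le_trans _ _ (\sum_(0 <= j < n) (a * z ^+ j)%:E)%E).
  exact: lee_sum.
rewrite sumEFin lee_fin; apply: (@geometric_le_lim _ n a z) => //.
by rewrite gtr0_norm.
Qed.

Section gaussian_variables.
Context disp (T : measurableType disp) (R : realType) (P : probability T R).
Implicit Types (Y Z : T -> R) (m s : R).

Lemma gaussianP Y : is_gaussian P Y -> exists m s, s = 0 /\
    (forall A : set R, measurable A -> P (Y @^-1` A) = \d_m A) \/ s != 0 /\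
    (forall A : set R, measurable A -> P (Y @^-1` A) = normal_prob m s A).
Proof.
move=> [m [s Yms]]; exists m, s; have [s0|s0] := eqVneq s 0; [left|right]; split => // A /Yms.
  by rewrite /gaussian_law s0 eqxx.
by rewrite /gaussian_law (negbTE s0).
Qed.

(** The number 34 is twice 17, where 17 M bounds the mean of a Gaussian variable with mass above 1/2
    in the ball of radius M. Beyond 34 M the mean uses up at most half of the deviation. *)
Definition tail_const (q : nat) : R := 2 * q`!%:R * (34 ^+ 2) ^+ q.

Lemma tail_const_gt0 q : 0 < tail_const q.
Proof.
by rewrite /tail_const mulr_gt0 ?exprn_gt0 ?mulr_gt0 ?ltr0n ?fact_gt0.
Qed.

(* Implied by Gaussianity, whose moment parameters it does not mention.  Since
   the hypothesis only asks for mass above 1/2 in a ball, one random bound for a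
   whole family gives tails which are uniform over the family; and since it is
   an open condition, the property passes to pointwise limits. *)
Definition tail_controlled Y := forall (q : nat) (M lam : R), 0 < M -> 0 < lam ->
  ((2^-1)%:E < P [set w | (`|Y w| < M)%R])%E ->
  (P [set w | (lam < `|Y w|)%R] <= (tail_const q * ((M / lam) ^+ 2) ^+ q)%:E)%E.

Let abs_ball (u e : R) : measurable [set x : R | `|x - u| <= e].
Proof.
apply: measurable_set_ler => //; apply: measurableT_comp => //.
exact: measurable_funB.
Qed.

Let abs_far (u e : R) : measurable [set x : R | e < `|x - u|].
Proof.
apply: measurable_set_ltr => //; apply: measurableT_comp => //.
exact: measurable_funB.
Qed.

Lemma gaussian_tail_controlled Y : measurable_fun setT Y -> is_gaussian P Y ->
  tail_controlled Y.
Proof.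
move=> mY gY q M lam M0 lam0 PM'.
have PM : ((2^-1)%:E < P [set w | (`|Y w| <= M)%R])%E.
  apply: lt_le_trans PM' _; apply: le_measure; rewrite ?inE; last by move=> w /ltW.
    by apply: measurable_set_ltr => //; exact: measurableT_comp.
  by apply: measurable_set_ler => //; exact: measurableT_comp.
have EM : [set w | `|Y w| <= M] = Y @^-1` [set x : R | `|x - 0| <= M].
  by apply/seteqP; split=> w /=; rewrite subr0.
have El : [set w | lam < `|Y w|] = Y @^-1` [set x : R | lam < `|x - 0|].
  by apply/seteqP; split=> w /=; rewrite subr0.
(* Below this threshold the claimed bound is at least 1. *)
have [lamM|Mlam] := leP lam (34 * M).
  apply: le_trans (probability_le1 _ _) _.
    by apply: measurable_set_ltr => //; exact: measurableT_comp.
  rewrite lee_fin /tail_const -mulrA -exprMn -[leLHS]mul1r ler_pM//.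
    by have : 1 <= q`!%:R :> R; [rewrite ler1n fact_gt0|lra].
  rewrite -exprMn exprn_ege1// exprn_ege1// mulrA ler_pdivlMr//; lra.
have [m [s [[_ Ym]|[s0 Ys]]]] := gaussianP gY.
  have PMm := Ym _ (abs_ball 0 M); have Plm := Ym _ (abs_far 0 lam).
  rewrite El Plm diracE; case: (boolP (m \in _)) => [|_]; last first.
    by rewrite lee_fin mulr_ge0 ?(ltW (tail_const_gt0 q))// exprn_ge0// sqr_ge0.
  rewrite inE/= subr0 => lm; move: PM; rewrite EM PMm diracE; case: (boolP (m \in _)) => [|_]; last by rewrite lte_fin/= => ?; exfalso; lra.
  by rewrite inE/= subr0 => mM _; exfalso; lra.
move: PM; rewrite EM Ys// => PM.
have as0 : 0 < `|s| by rewrite normr_gt0.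
(* The density is at most 1 / |s|, so the mass of the ball, which exceeds 1/2, is at most 2 M /
   |s|. *)
have sM : `|s| < 4 * M.
  have := lt_le_trans PM (normal_prob_ball m 0 s0 (ltW M0)); rewrite lte_fin.
  by rewrite ltr_pdivlMr//; lra.
have mM : `|m| <= 17 * M.
  (* Otherwise the whole ball would lie more than 4 |s| away from the mean, a region of mass at most
     6/16 < 1/2. *)
  have [z zM zm] : exists2 z, `|z| <= M & `|z - m| <= 4 * `|s|.
    apply: contrapT => nz; have h4 : 0 < 4 :> R by [].
    have := normal_prob_tail 1 m s0 h4; apply/negP; rewrite -ltNge.
    apply: (@lt_le_trans _ _ (2^-1)%:E); first by rewrite lte_fin (_ : 1`!%:R = 1 :> R)//; lra.
    apply: le_trans (ltW PM) _; apply: le_measure; rewrite ?inE.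
    - exact: abs_ball.
    - exact: abs_far.
    move=> x /=; rewrite subr0 => xM; rewrite ltNge; apply/negP => xm.
    by apply: nz; exists x.
  have : `|m| <= `|z| + `|z - m| by rewrite -{1}(subrK z m) addrC distrC ler_normD.
  lra.
rewrite El Ys//; pose t := lam / (2 * `|s|).
have t0 : 0 < t by rewrite divr_gt0// mulr_gt0.
apply: (@le_trans _ _ (normal_prob m s [set x | t * `|s| < `|x - m|])).
  apply: le_measure; rewrite ?inE; [exact: abs_far|exact: abs_far|].
  move=> x /=; rewrite subr0 => lx.
  have -> : t * `|s| = lam / 2 by rewrite /t; field; rewrite gt_eqF.
  have : `|x| <= `|x - m| + `|m| by rewrite -{1}(subrK m x) ler_normD.
  lra.
apply: le_trans (normal_prob_tail q m s0 t0) _; rewrite lee_fin /tail_const.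
rewrite -[leLHS]mulrA -[leRHS]mulrA ler_wpM2l ?mulr_ge0//.
have -> : 3 ^+ q / (t ^+ 2) ^+ q = (3 / t ^+ 2) ^+ q by rewrite [RHS]exprMn exprVn.
rewrite -[leRHS]exprMn; apply: lerXn2r; rewrite ?nnegrE.
- by rewrite divr_ge0 ?sqr_ge0.
- by rewrite mulr_ge0 ?sqr_ge0.
have -> : 3 / t ^+ 2 = 12 * `|s| ^+ 2 / lam ^+ 2.
  by rewrite /t; field; rewrite !gt_eqF.
rewrite exprMn exprVn mulrA ler_wpM2r ?invr_ge0 ?sqr_ge0//.
by have := normr_ge0 s; nra.
Qed.

Lemma sqr_le_dyadic (a : R) (J : nat) : 0 <= a -> a <= 2 ^+ J ->
  a ^+ 2 <= 1 + \sum_(0 <= j < J) 4 ^+ j.+1 * (2 ^+ j < a)%R%:R.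
Proof.
move=> a0; elim: J => [|J ih] aJ.
  by rewrite big_nil addr0 expr_le1.
rewrite big_nat_recr//=; have [aJ'|Ja] := leP a (2 ^+ J).
  by apply: le_trans (ih aJ') _; rewrite lerD2l lerDl mulr0.
rewrite mulr1 addrA; apply: (@le_trans _ _ (4 ^+ J.+1)).
  rewrite (_ : 4 = 2 ^+ 2); last by ring.
  by rewrite exprAC lerXn2r ?nnegrE.
by rewrite lerDr addr_ge0// sumr_ge0// => i _; rewrite mulr_ge0// exprn_ge0.
Qed.

(** This turns a lower bound for the variance into one for the parameter [s], which controls the
    density. The integral is decomposed dyadically according to the size of |Y - m| / |s|. *)
Lemma normal_second_moment Y m s : measurable_fun setT Y -> s != 0 ->
  (forall A : set R, measurable A -> P (Y @^-1` A) = normal_prob m s A) ->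
  (\int[P]_w ((Y w - m) ^+ 2)%:E <= (193 * s ^+ 2)%:E)%E.
Proof.
move=> mY s0 Ys.
have as0 : 0 < `|s| by rewrite normr_gt0.
pose A j := [set w | 2 ^+ j * `|s| < `|Y w - m|].
have mA j : measurable (A j).
  apply: measurable_set_ltr => //; apply: measurableT_comp => //.
  exact: measurable_funB.
pose g w := (\sum_(0 <= j <oo) (4 ^+ j.+1)%:E * (\1_(A j) w : R)%:E)%E.
have t0 w j : (0 <= (4 ^+ j.+1)%:E * (\1_(A j) w : R)%:E)%E.
  by rewrite mule_ge0// lee_fin// exprn_ge0.
have mt j : measurable_fun setT (fun w => (4 ^+ j.+1)%:E * (\1_(A j) w : R)%:E)%E.
  apply: emeasurable_funM => //; apply/measurable_EFinP; exact: measurable_indic.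
have mg : measurable_fun setT g by apply: ge0_emeasurable_sum => *; [exact: t0|exact: mt].
have Yg w : (((Y w - m) ^+ 2)%:E <= (s ^+ 2)%:E * (1 + g w))%E.
  pose a := `|Y w - m| / `|s|.
  have a0 : 0 <= a by rewrite divr_ge0.
  pose J := Num.truncn a.
  have aJ : a <= 2 ^+ J.+1.
    have /andP[_ aJ] := truncn_itv a0.
    apply: le_trans (ltW aJ) _; rewrite -natrX ler_nat ltnW// ltn_expl//.
  have -> : (Y w - m) ^+ 2 = s ^+ 2 * a ^+ 2.
    rewrite /a exprMn exprVn !real_normK ?num_real// mulrC mulfVK//.
    by rewrite sqrf_eq0.
  rewrite EFinM lee_wpmul2l ?lee_fin ?sqr_ge0//.
  apply: le_trans (_ : (1 + \sum_(0 <= j < J.+1) (4 ^+ j.+1)%:E * (\1_(A j) w : R)%:E <= _)%E).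
    rewrite (eq_bigr (fun j => (4 ^+ j.+1 * \1_(A j) w)%:E))// sumEFin -EFinD lee_fin.
    apply: le_trans (sqr_le_dyadic a0 aJ) _; rewrite lerD2l ler_sum// => j _.
    rewrite ler_wpM2l ?exprn_ge0// indicE /a ltr_pdivlMr//.
    case: (boolP (2 ^+ j * `|s| < `|Y w - m|)) => [h|//].
    by rewrite (mem_set (h : A j w)).
  by rewrite leeD2l// nneseries_lim_ge.
apply: (@le_trans _ _ (\int[P]_w ((s ^+ 2)%:E * (1 + g w)))%E).
  apply: ge0_le_integral => //.
  - by move=> w _; rewrite lee_fin sqr_ge0.
  - by apply/measurable_EFinP; apply: measurable_funX; exact: measurable_funB.
  - by apply: emeasurable_funM => //; exact: emeasurable_funD.
have g0 w : (0 <= g w)%E by apply: nneseries_ge0 => *; exact: t0.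
rewrite ge0_integralZl_EFin ?sqr_ge0//; last 2 first.
- by move=> w _; rewrite adde_ge0.
- exact: emeasurable_funD.
rewrite ge0_integralD// integral_cst//. rewrite mul1e [X in (X + _)%E](@probability_setT _ _ _ P).
rewrite [leRHS]EFinM [leRHS]muleC lee_wpmul2l ?lee_fin ?sqr_ge0//.
(* Layer j contributes at most 4^(j+1) * 36 / 16^j = 144 / 4^j, where 36 comes from the tail bound
   with exponent 2. *)
rewrite (_ : 193 = 1 + 144 * (1 - 4^-1)^-1); last by field.
rewrite EFinD leeD2l// /g integral_nneseries//.
apply: nneseries_geometric_le => //.
- by rewrite invf_lt1// ltr1n.
- by move=> j; exact: integral_ge0.
move=> j; rewrite ge0_integralZl_EFin ?exprn_ge0//; last first.
  by apply/measurable_EFinP; exact: measurable_indic.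
rewrite integral_indic// setIT.
have j0 : 0 < 2 ^+ j :> R by rewrite exprn_gt0.
apply: (@le_trans _ _ ((4 ^+ j.+1)%:E * (2 * 2`!%:R * 3 ^+ 2 / ((2 ^+ j) ^+ 2) ^+ 2)%:E)%E).
  rewrite lee_wpmul2l ?lee_fin ?exprn_ge0//.
  have := normal_prob_tail 2 m s0 j0; rewrite -Ys//; exact: abs_far.
rewrite -EFinM lee_fin (_ : 2`!%:R = 2 :> R)// (_ : (2 ^+ j) ^+ 2 = 4 ^+ j); last first.
  by rewrite exprAC; congr (_ ^+ j); ring.
by rewrite exprS exprVn [leLHS](_ : _ = 144 * (4 ^+ j)^-1)//; field; rewrite expf_neq0.
Qed.

Lemma gaussian_small_ball (kappa : R) : 0 < kappa -> exists2 C : R, 0 <= C &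
  forall Y, measurable_fun setT Y -> is_gaussian P Y -> (kappa%:E < variance P Y)%E ->
  forall u e : R, 0 <= e -> (P [set w | (`|Y w - u| <= e)%R] <= (C * e)%:E)%E.
Proof.
move=> kappa0; pose c := Num.sqrt (kappa / 193).
have c0 : 0 < c by rewrite sqrtr_gt0 divr_gt0.
exists (2 / c) => [|Y mY gY kY u e e0]; first by rewrite divr_ge0// ltW.
(* The mean square deviation is smallest around the expectation; the statement for arbitrary [m]
   avoids identifying the expectation with the parameter of the law. *)
have VY m : (\int[P]_w ((Y w - m) ^+ 2)%:E < +oo ->
    variance P Y <= \int[P]_w ((Y w - m) ^+ 2)%:E)%E.
  move=> Es; pose Z := (Y \- cst m)%R.
  have mZ : measurable_fun setT Z by exact: measurable_funB.
  have Z2 : Z \in Lfun P 2%:E.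
    rewrite inE; apply/andP; split; rewrite inE//=.
    rewrite /finite_norm unlock poweR_lty//.
    apply: le_lt_trans Es; rewrite le_eqVlt; apply/orP; left; apply/eqP.
    by apply: eq_integral => w _; rewrite /= powR_mulrn// real_normK ?num_real.
  have YZ : Y = (Z \+ cst m)%R by apply/funext => w /=; rewrite subrK.
  rewrite {1}YZ varianceD_cst_r// varianceE// -[leRHS]sube0 leeB//.
    by rewrite unlock.
  exact: sqre_ge0.
have [m [s [[s0 Ym]|[s0 Ys]]]] := gaussianP gY.
  have E0 : (\int[P]_w ((Y w - m) ^+ 2)%:E = 0)%E.
    have mN : measurable [set x : R | x != m].
      by rewrite (_ : [set x | x != m] = ~` [set m]); [exact: measurableC|apply/seteqP; split=> x /eqP].
    rewrite (@ge0_negligible_integral _ _ _ P _ (Y @^-1` [set x | x != m]))//.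
    - by apply: integral0_eq => w [_ /=]/negP/negPn/eqP ->; rewrite subrr expr0n.
    - by rewrite -[X in measurable X]setTI; exact: mY.
    - by apply/measurable_EFinP; apply: measurable_funX; exact: measurable_funB.
    - by move=> w _; rewrite lee_fin sqr_ge0.
    - by apply: eq_trans (Ym _ mN) _; rewrite diracE memNset//= eqxx.
  have := VY m; rewrite E0 => /(_ (ltry _)) V0.
  by have := lt_le_trans kY V0; rewrite lte_fin ltNge (ltW kappa0).
have Es := normal_second_moment mY s0 Ys.
have := lt_le_trans kY (le_trans (VY m (le_lt_trans Es (ltry _))) Es).
rewrite lte_fin => ks.
have cs : c <= `|s|.
  by rewrite -sqrtr_sqr ler_wsqrtr// ler_pdivrMr// mulrC ltW.
rewrite (_ : [set w | _] = Y @^-1` [set x | `|x - u| <= e])// Ys//.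
apply: le_trans (normal_prob_ball m u s0 e0) _; rewrite lee_fin mulrAC.
by rewrite ler_wpM2r// ler_wpM2l// lef_pV2 ?posrE ?normr_gt0.
Qed.

(** Fatou's lemma for events: continuity from below along the sets of points that lie in [A] and in
    every [B n] with [n >= N]. *)
Lemma probability_liminf_gt (A : set T) (B : nat -> set T) (c : \bar R) :
  measurable A -> (forall n, measurable (B n)) ->
  (forall w, A w -> \forall n \near \oo, B n w) -> (c < P A)%E ->
  exists N, forall n, (N <= n)%N -> (c < P (B n))%E.
Proof.
move=> mA mB AB cA; pose F N := A `&` \bigcap_(n in [set n | (N <= n)%N]) B n.
have mF N : measurable (F N).
  by apply: measurableI => //; apply: bigcap_measurable => [|n _]; [by exists N => /=|exact: mB].
have FU : \bigcup_N F N = A.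
  apply/seteqP; split=> [w [N _ []//]|w Aw].
  by have [N _ NB] := AB w Aw; exists N => //; split => // n; exact: NB.
have ndF : nondecreasing_seq F.
  move=> m n mn; apply/subsetPset => w [Aw Bw]; split => // k nk.
  by apply: Bw; exact: leq_trans nk.
have [N cN] : exists N, (c < P (F N))%E.
  apply: contrapT => /forallNP h; move: cA; apply/negP; rewrite -leNgt.
  have mU : measurable (\bigcup_N F N) by rewrite FU.
  have Fc := @nondecreasing_cvg_mu _ _ _ P F mF mU ndF.
  rewrite FU in Fc; rewrite -(cvg_lim _ Fc)//; apply: lime_le; first by apply/cvg_ex; eexists; exact: Fc.
  by apply: nearW => N /=; rewrite leNgt; apply/negP; exact: h.
exists N => n Nn; apply: lt_le_trans cN _; apply: le_measure; rewrite ?inE//.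
by move=> w [_]; exact.
Qed.

Lemma tail_controlled_cvg (Z : nat -> T -> R) Y :
  (forall n, measurable_fun setT (Z n)) -> measurable_fun setT Y ->
  (forall w, Z n w @[n --> \oo] --> Y w) -> (forall n, tail_controlled (Z n)) ->
  tail_controlled Y.
Proof.
move=> mZ mY ZY tZ q M lam M0 lam0 PM.
have absZ w : `|Z n w| @[n --> \oo] --> `|Y w| by apply: cvg_norm.
have mabs (V : T -> R) : measurable_fun setT V -> measurable_fun setT (fun w => `|V w|).
  by move=> mV; exact: measurableT_comp.
have [N1 N1P] : exists N, forall n, (N <= n)%N ->
    ((2^-1)%:E < P [set w | (`|Z n w| < M)%R])%E.
  apply: probability_liminf_gt PM => [|n|w /= YM].
  - by apply: measurable_set_ltr => //; exact: mabs.
  - by apply: measurable_set_ltr => //; exact: mabs.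
  - by apply: (cvgr_lt _ (absZ w)).
(* A failure of the tail bound is again a strict lower bound for the probability of an open
   condition, so it would pass to [Z n] for large [n]. *)
rewrite leNgt; apply/negP => Plam.
have [N2 N2P] : exists N, forall n, (N <= n)%N ->
    ((tail_const q * ((M / lam) ^+ 2) ^+ q)%:E < P [set w | (lam < `|Z n w|)%R])%E.
  apply: probability_liminf_gt Plam => [|n|w /= YM].
  - by apply: measurable_set_ltr => //; exact: mabs.
  - by apply: measurable_set_ltr => //; exact: mabs.
  - by apply: (cvgr_gt _ (absZ w)).
have := tZ (maxn N1 N2) q M lam M0 lam0 (N1P _ (leq_maxl _ _)).
by rewrite leNgt N2P// leq_maxr.
Qed.

End gaussian_variables.

(** * Tails of derivatives as limits of finite combinations *)

Section gaussian_field_derivatives.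
Context disp (T : measurableType disp) (R : realType) (P : probability T R).
Context (d : nat) (X : 'rV[R]_d -> T -> R).
Hypothesis mX : forall t, measurable_fun setT (X t).
Hypothesis gX : forall (n : nat) (t : 'I_n -> 'rV[R]_d) (a : 'I_n -> R),
  is_gaussian P (fun w => \sum_(i < n) a i * X (t i) w).
Hypothesis sX : forall w, smooth (fun t => X t w).

Local Notation path w := (fun t => X t w).

(** Combinations over arbitrary lists are stable under difference quotients. They contain both
    single values and differences of values, the two cases needed for chaining. *)
Definition pd_comb (s : seq 'I_d) (L : seq (R * 'rV[R]_d)) (w : T) : R :=
  \sum_(p <- L) p.1 * pd s (path w) p.2.

Lemma derive_cvg_seq (f : 'rV[R]_d -> R) x v : derivable f x v ->
  n.+1%:R * (f (x + n.+1%:R^-1 *: v) - f x) @[n --> \oo] --> 'D_v f x.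
Proof.
move=> df; have h0 : (n.+1%:R^-1 : R) @[n --> \oo] --> (0 : R)^'.
  move=> A /= A0; have hA : \forall n \near \oo, n.+1%:R^-1 != 0 :> R -> A (n.+1%:R^-1 : R).
    exact: (@cvg_harmonic R _ A0).
  by apply: filterS hA => n; apply; rewrite invr_eq0.
rewrite [X in X @ _ --> _](_ : _ =
    (fun h => h^-1 *: ((f \o shift x) (h *: v) - f x)) \o (fun n => n.+1%:R^-1)).
  exact: cvg_comp h0 df.
by apply/funext => n /=; rewrite invrK [_ + x]addrC /GRing.scale.
Qed.

(** One more derivative is a pointwise limit of difference quotients, which are combinations of the
    same kind with a longer list; hence the induction on [s] with [L] arbitrary. *)
Lemma pd_comb_tail (s : seq 'I_d) (L : seq (R * 'rV[R]_d)) :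
  measurable_fun setT (pd_comb s L) /\ tail_controlled P (pd_comb s L).
Proof.
elim: s L => [|i s ih] L.
  have mL : measurable_fun setT (pd_comb [::] L).
    by apply: measurable_sum => p; apply: measurable_funM => //; exact: mX.
  split => //; apply: gaussian_tail_controlled => //.
  have := gX (fun j => (tnth (in_tuple L) j).2) (fun j => (tnth (in_tuple L) j).1).
  congr (is_gaussian _ _); apply/funext => w.
  by rewrite /pd_comb [in RHS]big_tnth/=; apply: eq_bigr.
pose h n : R := n.+1%:R^-1.
pose LL n := [seq (p.1 * n.+1%:R, p.2 + h n *: delta_mx 0 i) | p <- L] ++
             [seq (- (p.1 * n.+1%:R), p.2) | p <- L].
have cvgL w : pd_comb s (LL n) w @[n --> \oo] --> pd_comb (i :: s) L w.
  have E n : pd_comb s (LL n) w = \sum_(p <- L) p.1 * (n.+1%:R *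
      (pd s (path w) (p.2 + h n *: delta_mx 0 i) - pd s (path w) p.2)).
    rewrite /pd_comb /LL big_cat/= !big_map/= -big_split/=.
    by apply: eq_bigr => p _; ring.
  under eq_fun do rewrite E.
  apply: cvg_sumr => p; apply: cvgMl_tmp; apply: derive_cvg_seq.
  by case: (smooth_is_derive p.2 i (smooth_pd s (sX w))).
have mL : measurable_fun setT (pd_comb (i :: s) L).
  apply: (@measurable_fun_cvg _ _ _ _ (fun n => pd_comb s (LL n))).
    by move=> n; case: (ih (LL n)).
  by move=> w _; exact: cvgL.
split => //; apply: (@tail_controlled_cvg _ _ _ _ (fun n => pd_comb s (LL n))) => //.
- by move=> n; case: (ih (LL n)).
- by move=> n; case: (ih (LL n)).
Qed.

End gaussian_field_derivatives.

(** * Suprema of derivatives by chaining *)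

Lemma union_bound disp (T : measurableType disp) (R : realType)
    (P : probability T R) (I : finType) (A : I -> set T) (c : R) :
  (forall b, measurable (A b)) -> (forall b, (P (A b) <= c%:E)%E) ->
  measurable [set w | exists b, A b w] /\
  (P [set w | exists b, A b w] <= (#|I|%:R * c)%:E)%E.
Proof.
move=> mA Ac; pose U (s : seq I) := [set w | exists2 b, b \in s & A b w].
have US s : measurable (U s) /\ (P (U s) <= ((size s)%:R * c)%:E)%E.
  elim: s => [|b s [mU Uc]].
    rewrite (_ : U [::] = set0); last by apply/seteqP; split=> w // [b].
    by split; [exact: measurable0|rewrite measure0 mul0r lexx].
  have -> : U (b :: s) = A b `|` U s.
    apply/seteqP; split=> w /=.
      by move=> [b']; rewrite inE => /predU1P[->|bs] Aw; [left|right; exists b'].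
    by move=> [Aw|[b' bs Aw]]; [exists b; rewrite // inE eqxx|exists b'; rewrite // inE bs orbT].
  split; first exact: measurableU.
  apply: le_trans (measureU2 _ _ _) _ => //.
  by rewrite /= -natr1 mulrDl mul1r addrC EFinD leeD.
have -> : [set w | exists b, A b w] = U (enum I).
  by apply/seteqP; split=> w [b Ab]; exists b => //; rewrite mem_enum.
by rewrite cardE.
Qed.

Section grids.
Context {R : realType} {d : nat}.
Implicit Types (x : 'rV[R]_d) (r h i : nat).

Definition grid_index r h := {ffun 'I_d -> 'I_(2 * r * h).+1}.

Definition grid_point r h (b : grid_index r h) : 'rV[R]_d :=
  \row_k ((b k)%:R / h%:R - r%:R).

Lemma grid_point_norm r h (b : grid_index r h) : (0 < h)%N ->
  `|grid_point b| <= r%:R.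
Proof.
move=> h0; apply: normr_rowP => // k; rewrite mxE ler_norml.
have hb : (b k)%:R <= (2 * r%:R) * h%:R :> R.
  by move: (nat_of_ord (b k)) (ltn_ord (b k)) => c cl; rewrite -!natrM ler_nat -ltnS.
have h0R : 0 < h%:R :> R by rewrite ltr0n.
apply/andP; split; first by rewrite lerBrDr addrC subrr divr_ge0.
by rewrite lerBlDr ler_pdivrMr//; lra.
Qed.

Section cell.
Variables (r h : nat) (x : 'rV[R]_d).
Hypothesis xr : `|x| <= r%:R.

Let xr0 k : 0 <= x 0 k + r%:R.
Proof. by have := le_trans (normr_coord x k) xr; rewrite ler_norml => /andP[]; lra. Qed.

Lemma grid_cell_lt (k : 'I_d) : (Num.truncn ((x 0 k + r%:R) * h%:R)%R < (2 * r * h).+1)%N.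
Proof.
rewrite truncn_lt_nat; last by rewrite mulr_ge0 ?xr0.
rewrite -[ltRHS]natr1 natrM natrM ltr_pwDr//.
rewrite ler_wpM2r//.
by have := le_trans (normr_coord x k) xr; rewrite ler_norml => /andP[_]; lra.
Qed.

Definition grid_cell : grid_index r h := [ffun k => Ordinal (grid_cell_lt k)].

Lemma grid_cell_dist : (0 < h)%N -> `|x - grid_point grid_cell| <= h%:R^-1.
Proof.
move=> h0; have h0R : 0 < h%:R :> R by rewrite ltr0n.
apply: normr_rowP => [|k]; first by rewrite invr_ge0.
rewrite !mxE /grid_cell ffunE/=.
set y := (x 0 k + r%:R) * h%:R.
have y0 : 0 <= y by rewrite mulr_ge0 ?xr0.
have /andP[h1 h2] := truncn_itv y0.
rewrite opprB addrA (_ : x 0 k + r%:R = y / h%:R); last first.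
  by rewrite /y mulfK// gt_eqF.
rewrite -mulrBl ger0_norm ?divr_ge0 ?subr_ge0//.
rewrite ler_piMl ?invr_ge0// lerBlDl; rewrite -natr1 in h2; exact: ltW.
Qed.

End cell.

Section dyadic_grids.
Variable r : nat.

Lemma grid_parent_lt i (b : grid_index r (4 ^ i.+1)) k : (b k %/ 4 < (2 * r * 4 ^ i).+1)%N.
Proof.
move: (nat_of_ord (b k)) (ltn_ord (b k)) => c; rewrite !ltnS => cl.
rewrite -(@leq_pmul2r 4)//; apply: leq_trans (leq_divM _ _) _.
by rewrite -mulnA -expnSr.
Qed.

(** Meshes shrink by the factor 4 while the chaining thresholds shrink by 2. The threshold relative
    to the expected size of an increment thus grows like 2^i, which beats the number of links. *)
Definition grid_parent i (b : grid_index r (4 ^ i.+1)) : grid_index r (4 ^ i) :=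
  [ffun k => Ordinal (grid_parent_lt b k)].

Lemma grid_parent_dist i (b : grid_index r (4 ^ i.+1)) :
  `|grid_point b - grid_point (grid_parent b)| <= (4 ^+ i)^-1.
Proof.
have i0 : 0 < 4 ^+ i :> R by rewrite exprn_gt0.
apply: normr_rowP => [|k]; first by rewrite invr_ge0 ltW.
rewrite !mxE ffunE/= opprB addrA subrK !natrX exprS.
have -> : (b k)%:R / (4 * 4 ^+ i) - (b k %/ 4)%:R / 4 ^+ i =
    (b k %% 4)%:R / 4 / 4 ^+ i :> R.
  rewrite {1}(divn_eq (b k) 4) natrD natrM; field; exact: lt0r_neq0.
rewrite ger0_norm ?divr_ge0 ?(ltW i0)// ler_piMl ?invr_ge0 ?(ltW i0)//.
by rewrite ler_pdivrMr// mul1r ler_nat ltnW// ltn_mod.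
Qed.

(** Rounding 4 y down and then dividing by 4 rounds y down, so the approximations of [x] at
    consecutive levels are linked by [grid_parent]. *)
Lemma grid_parent_cell i x (xr : `|x| <= r%:R) :
  grid_parent (grid_cell (4 ^ i.+1) xr) = grid_cell (4 ^ i) xr.
Proof.
apply/ffunP => k; apply/val_inj; rewrite ffunE/= /grid_cell !ffunE/=.
set y := (x 0 k + r%:R) * (4 ^ i)%:R.
have -> : (x 0 k + r%:R) * (4 ^ i.+1)%:R = 4 * y by rewrite /y expnS natrM; ring.
have y0 : 0 <= y.
  rewrite mulr_ge0//.
  by have := le_trans (normr_coord x k) xr; rewrite ler_norml => /andP[]; lra.
have y40 : 0 <= 4 * y by rewrite mulr_ge0.
apply/esym/truncn_def.
have /andP[h1 h2] := truncn_itv y40.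
have := divn_eq (Num.truncn (4 * y)) 4; have := ltn_mod (Num.truncn (4 * y)) 4.
set n := Num.truncn (4 * y) in h1 h2 *; set a := (n %/ 4)%N; set c := (n %% 4)%N.
move=> c4 nE; rewrite nE in h1 h2.
have {}c4 : c%:R <= 3 :> R by rewrite ler_nat -ltnS.
have c0 : 0 <= c%:R :> R by [].
move: h1 h2; rewrite -!natr1 natrD natrM => h1 h2; apply/andP; split; lra.
Qed.

End dyadic_grids.

End grids.

Section chaining.
Context disp (T : measurableType disp) (R : realType) (P : probability T R).
Context (d : nat) (F : 'rV[R]_d -> T -> R) (r : nat).
Hypothesis mF : forall x, measurable_fun setT (F x).
Hypothesis tF : forall x, tail_controlled P (F x).
Hypothesis tdF : forall x y, tail_controlled P (fun w => F x w - F y w).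
Hypothesis lF : forall w, exists2 L : R, 0 <= L &
  forall x y, `|x| <= r%:R -> `|y| <= r%:R -> `|F x w - F y w| <= L * `|x - y|.

Let g4 i : (0 < 4 ^ i)%N. Proof. by rewrite expn_gt0. Qed.

(** The links of the chain, with the values on the coarsest lattice as level 0. A link of level i >=
    1 has length at most 1 / 4^(i-1), whence the exponents [i.-1] below. *)
Definition grid_incr (i : nat) : @grid_index d r (4 ^ i) -> T -> R :=
  match i with
  | 0 => fun b w => F (grid_point b) w
  | j.+1 => fun b w => F (grid_point b) w - F (grid_point (grid_parent b)) w
  end.

Lemma measurable_grid_incr i b : measurable_fun setT (@grid_incr i b).
Proof. by case: i b => [|i] b; [exact: mF|apply: measurable_funB; exact: mF]. Qed.

Lemma grid_incr_tail i b : tail_controlled P (@grid_incr i b).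
Proof. by case: i b => [|i] b; [exact: tF|exact: tdF]. Qed.

Lemma measurable_grid_incr_gt (a : nat -> R) :
  measurable [set w | exists i b, a i < `|@grid_incr i b w|].
Proof.
rewrite (_ : [set w | _] = \bigcup_i [set w | exists b, a i < `|@grid_incr i b w|]); last first.
  by apply/seteqP; split=> w; [move=> [i h]; exists i|move=> [i _ h]; exists i].
apply: bigcupT_measurable => i.
apply: (@union_bound _ _ _ P _ (fun b => [set w | a i < `|@grid_incr i b w|]) 1 _ _).1 => b.
  apply: measurable_set_ltr => //; apply: measurableT_comp => //.
  exact: measurable_grid_incr.
apply: probability_le1; apply: measurable_set_ltr => //; apply: measurableT_comp => //.
exact: measurable_grid_incr.
Qed.

(* The paths being Lipschitz, the scaled increments have a common, random,
   bound; [M] is a median of it. *)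
Lemma grid_incr_median : exists2 M : R, 0 < M &
  forall i b, ((2^-1)%:E < P [set w | (`|@grid_incr i b w| < M / 4 ^+ i.-1)%R])%E.
Proof.
pose A (M : nat) := ~` [set w | exists i b, M%:R / 2 / 4 ^+ i.-1 < `|@grid_incr i b w|].
have mA M : measurable (A M) by apply: measurableC; exact: measurable_grid_incr_gt.
have [N NP] : exists N, forall n, (N <= n)%N -> ((2^-1)%:E < P (A n))%E.
  apply: (@probability_liminf_gt _ _ _ P setT) => //; last first.
    by rewrite probability_setT lte_fin invf_lt1// ltr1n.
  move=> w _; have [L L0 wL] := lF w.
  pose N := (Num.truncn (2 * (`|F 0 w| + L * r%:R + L))).+1.
  exists N => // n /= Nn [i [b]]; apply/negP; rewrite -leNgt.
  have nN : `|F 0 w| + L * r%:R + L <= n%:R / 2.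
    rewrite ler_pdivlMr// mulrC; apply: (@le_trans _ _ N%:R); last by rewrite ler_nat.
    by rewrite ltW// -truncn_le_nat.
  have r0 : 0 <= L * r%:R by rewrite mulr_ge0.
  case: i b => [|i] b /=.
    rewrite expr0 divr1; apply: le_trans nN.
    have z0 : `|0 : 'rV[R]_d| <= r%:R by rewrite normr0.
    have := wL _ _ (grid_point_norm b (g4 _)) z0; rewrite subr0 => h.
    have := ler_wpM2l L0 (grid_point_norm b (g4 _)).
    have : `|F (grid_point b) w| <= `|F (grid_point b) w - F 0 w| + `|F 0 w|.
      by rewrite -{1}(subrK (F 0 w) (F (grid_point b) w)) ler_normD.
    lra.
  apply: le_trans (wL _ _ (grid_point_norm _ (g4 _)) (grid_point_norm _ (g4 _))) _.
  apply: ler_pM => //; last exact: grid_parent_dist.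
  by have := normr_ge0 (F 0 w); lra.
exists N.+1%:R => // i b; apply: lt_le_trans (NP N.+1 (leqnSn _)) _.
apply: le_measure; rewrite ?inE//.
  apply: measurable_set_ltr => //; apply: measurableT_comp => //.
  exact: measurable_grid_incr.
move=> w Aw /=; rewrite ltNge; apply/negP => h; apply: Aw; exists i, b.
apply: lt_le_trans h; rewrite ltr_pM2r ?invr_gt0 ?exprn_gt0//.
by rewrite ltr_pdivrMr// ltr_pMr// ltr1n.
Qed.

(** The thresholds sum to lam + lam (1 + 1/2 + 1/4 + ...) = 3 lam. The Lipschitz bound of the path
    passes from lattice points to all points, its random constant being absorbed by a fine enough
    level. *)
Lemma chaining_bound (w : T) (lam : R) : 0 <= lam ->
  ~ (exists i b, lam / 2 ^+ i.-1 < `|@grid_incr i b w|) ->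
  forall x, `|x| <= r%:R -> `|F x w| <= 3 * lam.
Proof.
move=> lam0 nw x xr; have incr_le i b : `|@grid_incr i b w| <= lam / 2 ^+ i.-1.
  by rewrite leNgt; apply/negP => h; apply: nw; exists i, b.
have p i : `|F (grid_point (grid_cell (4 ^ i) xr)) w| <= lam * (3 - 2 / 2 ^+ i).
  elim: i => [|i ih].
    have := @incr_le 0%N (grid_cell (4 ^ 0) xr); rewrite /= expr0 !divr1; lra.
  have := @incr_le i.+1 (grid_cell (4 ^ i.+1) xr); rewrite /= grid_parent_cell => h.
  set u := F (grid_point (grid_cell (4 ^ i.+1) xr)) w in h *.
  set v := F (grid_point (grid_cell (4 ^ i) xr)) w in h ih *.
  have : `|u| <= `|u - v| + `|v| by rewrite -{1}(subrK v u) ler_normD.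
  have -> : lam * (3 - 2 / 2 ^+ i.+1) = lam / 2 ^+ i + lam * (3 - 2 / 2 ^+ i).
    by rewrite exprS; field; rewrite expf_neq0.
  lra.
have [L L0 wL] := lF w.
apply/ler_addgt0Pr => e e0.
pose i := Num.truncn (L / e).
have Le : L / 4 ^+ i <= e.
  rewrite ler_pdivrMr ?exprn_gt0// mulrC -ler_pdivrMr//.
  have /andP[_ h] := truncn_itv (divr_ge0 L0 (ltW e0)).
  by apply: le_trans (ltW h) _; rewrite -natrX ler_nat ltn_expl.
have h1 := wL _ _ xr (grid_point_norm (grid_cell (4 ^ i) xr) (g4 i)).
have h2 := ler_wpM2l L0 (grid_cell_dist xr (g4 i)); rewrite natrX in h2.
have h3 := p i.
have h4 : lam * (3 - 2 / 2 ^+ i) <= 3 * lam.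
  rewrite mulrC ler_wpM2r// gerBl divr_ge0// exprn_ge0//.
have : `|F x w| <= `|F x w - F (grid_point (grid_cell (4 ^ i) xr)) w| +
    `|F (grid_point (grid_cell (4 ^ i) xr)) w|.
  by rewrite -{1}(subrK (F (grid_point (grid_cell (4 ^ i) xr)) w) (F x w)) ler_normD.
lra.
Qed.

Lemma grid_index_card i : #|{: @grid_index d r (4 ^ i)}|%:R <= ((2 * r%:R + 1) * 4) ^+ d * (4 ^+ d) ^+ i.-1 :> R.
Proof.
rewrite card_ffun !card_ord natrX exprAC -exprMn; apply: lerXn2r; rewrite ?nnegrE//.
rewrite -mulrA; apply: (@le_trans _ _ ((2 * r%:R + 1) * 4 ^+ i)).
  rewrite -[leLHS]natr1 natrM natrM natrX [leRHS]mulrDl mul1r lerD2l.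
  by rewrite exprn_ege1// ler1n.
rewrite ler_wpM2l ?addr_ge0 ?mulr_ge0//; case: i => [|i]; last by rewrite exprS.
by rewrite expr0 mulr1 ler1n.
Qed.

(** The supremum is handled through an exceptional event, measurable as a countable union over the
    links. *)
Lemma chaining_tail (q0 : nat) : exists2 C : R, 0 <= C & forall lam : R, 1 <= lam ->
  exists2 B : set T, measurable B /\ (P B <= (C / lam ^+ q0)%:E)%E &
    forall w, ~ B w -> forall x, `|x| <= r%:R -> `|F x w| <= 3 * lam.
Proof.
have [M M0 hM] := grid_incr_median.
(* About 4^(d i) links of level i fail with probability of order lam^(-2q) 4^(-q i) each. The excess
   of [q] over [d] makes the sum over levels geometric, and [q0] is left for the decay in [lam]. The
   factor 4 in [C] pays for [i.-1] in place of [i]. *)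
pose q := (d.+1 + q0)%N.
pose D : R := ((2 * r%:R + 1) * 4) ^+ d.
have D0 : 0 <= D by rewrite exprn_ge0// mulr_ge0// addr_ge0// mulr_ge0.
pose C := 4 * (D * (tail_const R q * (M ^+ 2) ^+ q)).
have tc0 := ltW (tail_const_gt0 R q).
have C0 : 0 <= C by rewrite mulr_ge0// mulr_ge0// mulr_ge0// exprn_ge0// sqr_ge0.
exists (C * (1 - 4^-1)^-1) => [|lam lam1].
  by rewrite mulr_ge0// invr_ge0 subr_ge0 invf_le1// ler1n.
have lam0 : 0 < lam by exact: lt_le_trans lam1.
pose a i := lam / 2 ^+ i.-1.
have a0 i : 0 < a i by rewrite divr_gt0// exprn_gt0.
pose E i := [set w | exists b, a i < `|@grid_incr i b w|].
pose B := [set w | exists i b, a i < `|@grid_incr i b w|].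
have mb i b : measurable [set w | a i < `|@grid_incr i b w|].
  apply: measurable_set_ltr => //; apply: measurableT_comp => //.
  exact: measurable_grid_incr.
have Pb i b : (P [set w | (a i < `|@grid_incr i b w|)%R] <=
    (tail_const R q * (((M / 4 ^+ i.-1) / a i) ^+ 2) ^+ q)%:E)%E.
  by apply: (@grid_incr_tail i b) => //; rewrite divr_gt0// exprn_gt0.
have ME i := union_bound (mb i) (Pb i).
have Eg i : (P (E i) <= (C / lam ^+ q0 * (4^-1) ^+ i)%:E)%E.
  apply: le_trans (ME i).2 _; rewrite lee_fin.
  have x0 (x : R) k : 0 <= (x ^+ 2) ^+ k by rewrite exprn_ge0// sqr_ge0.
  have y0 k l : 0 <= (4 ^+ k) ^+ l :> R by rewrite !exprn_ge0.
  set j := i.-1; have i4 : 0 < 4 ^+ j :> R by rewrite exprn_gt0.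
  have -> : ((M / 4 ^+ j / a i) ^+ 2) ^+ q =
      (M ^+ 2) ^+ q / (lam ^+ 2) ^+ q / (4 ^+ q) ^+ j.
    rewrite (_ : (M / 4 ^+ j / a i) ^+ 2 = M ^+ 2 / lam ^+ 2 / 4 ^+ j).
      by rewrite [LHS]exprMn exprVn [X in X / _]exprMn exprVn (exprAC 4 j q).
    have -> : 4 ^+ j = 2 ^+ j * 2 ^+ j :> R by rewrite -exprMn; congr (_ ^+ j); ring.
    have p2 : 2 ^+ j != 0 :> R by rewrite expf_neq0.
    by rewrite /a -/j; field; rewrite p2 gt_eqF.
  apply: le_trans (ler_wpM2r _ (grid_index_card i)) _.
    by rewrite mulr_ge0// !divr_ge0.
  rewrite -/D -/j.
  have -> : D * (4 ^+ d) ^+ j * (tail_const R q *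
      ((M ^+ 2) ^+ q / (lam ^+ 2) ^+ q / (4 ^+ q) ^+ j)) =
      D * (tail_const R q * (M ^+ 2) ^+ q) * (((lam ^+ 2) ^+ q)^-1 *
      ((4 ^+ d) ^+ j / (4 ^+ q) ^+ j)) by ring.
  have -> : C / lam ^+ q0 * 4^-1 ^+ i = D * (tail_const R q * (M ^+ 2) ^+ q) *
      ((lam ^+ q0)^-1 * (4 / 4 ^+ i)) by rewrite /C exprVn; ring.
  apply: ler_wpM2l; first by rewrite mulr_ge0// mulr_ge0.
  apply: ler_pM.
  - by rewrite invr_ge0 exprn_ge0 ?sqr_ge0.
  - by rewrite divr_ge0// !exprn_ge0.
  - rewrite lef_pV2 ?posrE ?exprn_gt0// -exprM ler_weXn2l// /q; lia.
  - rewrite ler_pdivrMr ?exprn_gt0// mulrAC ler_pdivlMr ?exprn_gt0//.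
    rewrite -!exprM -exprD -exprS ler_weXn2l ?ler1n//.
    by rewrite /q /j; case: (i) => [|i'] /=; lia.
exists B; last by move=> w nB x xr; apply: chaining_bound => //; exact: ltW.
split; first exact: measurable_grid_incr_gt.
rewrite mulrAC.
apply: (@le_trans _ _ (\sum_(0 <= i <oo) P (E i))%E).
  apply: measure_sigma_subadditive => [i||].
  - exact: (ME i).1.
  - exact: measurable_grid_incr_gt.
  - by move=> w [i [b h]]; exists i => //; exists b.
apply: nneseries_geometric_le => //.
- by rewrite divr_ge0// exprn_ge0// ltW.
- by rewrite invf_lt1// ltr1n.
Qed.

End chaining.

Section derivative_suprema.
Context disp (T : measurableType disp) (R : realType) (P : probability T R).
Context (d : nat) (X : 'rV[R]_d -> T -> R).
Hypothesis mX : forall t, measurable_fun setT (X t).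
Hypothesis gX : forall (n : nat) (t : 'I_n -> 'rV[R]_d) (a : 'I_n -> R),
  is_gaussian P (fun w => \sum_(i < n) a i * X (t i) w).
Hypothesis sX : forall w, smooth (fun t => X t w).
Variables (r q : nat).

Lemma pd_sup_tail (s : seq 'I_d) : exists2 C : R, 0 <= C & forall lam : R, 1 <= lam ->
  exists2 B : set T, measurable B /\ (P B <= (C / lam ^+ q)%:E)%E &
    forall w, ~ B w -> forall x, `|x| <= r%:R -> `|pd s (fun t => X t w) x| <= 3 * lam.
Proof.
pose F x w := pd s (fun t => X t w) x.
have F1 x : F x = pd_comb X s [:: (1, x)].
  by apply/funext => w; rewrite /pd_comb big_seq1 mul1r.
have F2 x y : (fun w => F x w - F y w) = pd_comb X s [:: (1, x); (-1, y)].
  by apply/funext => w; rewrite /pd_comb big_cons big_seq1 mul1r mulN1r.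
apply: (@chaining_tail _ _ _ P _ F).
- by move=> x; rewrite F1; exact: (pd_comb_tail mX gX sX s _).1.
- by move=> x; rewrite F1; exact: (pd_comb_tail mX gX sX s _).2.
- by move=> x y; rewrite F2; exact: (pd_comb_tail mX gX sX s _).2.
- by move=> w; exact: smooth_lipschitz (smooth_pd s (sX w)).
Qed.

Lemma pd_sup_tail_uniform (n : nat) : exists2 C : R, 0 <= C & forall lam : R, 1 <= lam ->
  exists2 B : set T, measurable B /\ (P B <= (C / lam ^+ q)%:E)%E &
    forall w, ~ B w -> forall s x, size s = n -> `|x| <= r%:R ->
      `|pd s (fun t => X t w) x| <= 3 * lam.
Proof.
pose QC (s : n.-tuple 'I_d) (C : R) := 0 <= C /\ forall lam : R, 1 <= lam ->
  exists2 B : set T, measurable B /\ (P B <= (C / lam ^+ q)%:E)%E &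
    forall w, ~ B w -> forall x, `|x| <= r%:R -> `|pd s (fun t => X t w) x| <= 3 * lam.
have [C CP] := @choice _ _ QC (fun s =>
  let: ex_intro2 C C0 CP := pd_sup_tail s in ex_intro _ C (conj C0 CP)).
have C0 s : 0 <= C s by case: (CP s).
exists (#|{: n.-tuple 'I_d}|%:R * \sum_s C s) => [|lam lam1].
  by rewrite mulr_ge0// sumr_ge0.
pose QB (s : n.-tuple 'I_d) (B : set T) :=
  (measurable B /\ (P B <= (C s / lam ^+ q)%:E)%E) /\
  forall w, ~ B w -> forall x, `|x| <= r%:R -> `|pd s (fun t => X t w) x| <= 3 * lam.
have [B BP] := @choice _ _ QB (fun s =>
  let: ex_intro2 B mB BP := (CP s).2 lam lam1 in ex_intro _ B (conj mB BP)).
exists [set w | exists s, B s w].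
  rewrite -mulrA; apply: (@union_bound _ _ _ P _ B) => s; first by case: (BP s) => -[].
  apply: le_trans (BP s).1.2 _; rewrite lee_fin ler_wpM2r//.
    by rewrite invr_ge0 exprn_ge0// (le_trans ler01).
  by rewrite (bigD1 s)//= lerDl sumr_ge0.
move=> w nB s x sn xr; have sn' : size s == n by rewrite sn.
by apply: (BP (Tuple sn')).2 => // Bw; apply: nB; exists (Tuple sn').
Qed.

End derivative_suprema.

(** * Counting the zeros on lines *)

Section finite_counting.

Lemma count_fibers (A : Type) (N : nat) (h : A -> 'I_N) (s : seq A) :
  size s = (\sum_(l < N) count (fun x => h x == l) s)%N.
Proof.
elim: s => [|x s ih]; first by rewrite big1.
rewrite /= big_split/= -ih (bigD1 (h x))//= eqxx big1 ?addn0 ?add1n// => i ih'.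
by rewrite eq_sym (negbTE ih').
Qed.

Lemma pigeonhole_count (A : Type) (N k : nat) (h : A -> 'I_N) (s : seq A) :
  (N * k < size s)%N -> exists l, (k < count (fun x => h x == l) s)%N.
Proof.
move=> Nk; apply: contrapT => /forallNP nh; move: Nk; apply/negP; rewrite -leqNgt.
rewrite (count_fibers h) -[N in (_ <= N * _)%N](card_ord N) -sum_nat_const.
by apply: leq_sum => l _; rewrite leqNgt; apply/negP.
Qed.

Lemma counting_gt_seq (R : realType) (A : choiceType) (S : set A) (c : nat) :
  ((c%:R : R)%:E < counting S)%E ->
  exists s : seq A, [/\ uniq s, (c < size s)%N & forall x, x \in s -> S x].
Proof.
rewrite /counting; case: ifPn => [/asboolP fS|/asboolP iS _].
  rewrite lte_fin ltr_nat => cS; exists (finmap.enum_fset (fset_set S)); split => //.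
  by move=> x; rewrite in_fset_set// inE.
have [B BS cB] := infinite_set_fset c.+1 iS.
exists (finmap.enum_fset B); split => //.
Qed.

End finite_counting.

Section lines.
Context {R : realType} {d : nat}.
Implicit Types (x y v p : 'rV[R]_d.+1).

Definition proj v x : 'rV[R]_d.+1 := x - dotv x v *: v.

Lemma dotvDl x y v : dotv (x + y) v = dotv x v + dotv y v.
Proof. by rewrite /dotv -big_split/=; apply: eq_bigr => i _; rewrite mxE mulrDl. Qed.

Lemma dotvZl (a : R) x v : dotv (a *: x) v = a * dotv x v.
Proof. by rewrite /dotv mulr_sumr; apply: eq_bigr => i _; rewrite mxE mulrA. Qed.

Lemma dotvBl x y v : dotv (x - y) v = dotv x v - dotv y v.
Proof. by rewrite dotvDl -scaleN1r dotvZl mulN1r. Qed.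

Lemma dotv_unit v : norm2 v = 1 -> dotv v v = 1.
Proof. by move=> v1; rewrite -norm2_sqr v1 expr1n. Qed.

Lemma dotv_line v y (t : R) : norm2 v = 1 -> perp v y -> dotv (y + t *: v) v = t.
Proof. by move=> v1 yv; rewrite dotvDl dotvZl dotv_unit// mulr1 yv add0r. Qed.

Lemma proj_line v y (t : R) : norm2 v = 1 -> perp v y -> proj v (y + t *: v) = y.
Proof. by move=> v1 yv; rewrite /proj dotv_line// addrK. Qed.

Lemma dotv_le x v : norm2 v = 1 -> `|dotv x v| <= d.+1%:R * `|x|.
Proof.
move=> v1; apply: le_trans (ler_norm_sum _ _ _) _.
apply: (@le_trans _ _ (\sum_(i < d.+1) `|x|)); last first.
  by rewrite sumr_const card_ord [leRHS]mulr_natl.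
apply: ler_sum => i _; rewrite normrM -[leRHS]mulr1.
by apply: ler_pM; [exact: normr_ge0|exact: normr_ge0|exact: normr_coord|exact: unit_coord].
Qed.

Lemma projB v x y : proj v x - proj v y = proj v (x - y).
Proof. by rewrite /proj dotvBl; apply/rowP => i; rewrite !mxE; ring. Qed.

Lemma unit_norm_le v : norm2 v = 1 -> `|v| <= 1.
Proof. by move=> v1; apply: normr_rowP => // i; exact: unit_coord. Qed.

Lemma proj_le v x : norm2 v = 1 -> `|proj v x| <= d.+2%:R * `|x|.
Proof.
move=> v1; apply: le_trans (ler_normB _ _) _; rewrite normrZ.
have h : `|dotv x v| * `|v| <= d.+1%:R * `|x|.
  rewrite -[leRHS]mulr1; apply: ler_pM; [exact: normr_ge0|exact: normr_ge0| |].
    exact: dotv_le.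
  exact: unit_norm_le.
by rewrite -[d.+2%:R]natr1; lra.
Qed.

Lemma segment_norm_le (r : nat) v y (t t0 : R) : norm2 v = 1 ->
  `|y + t0 *: v| <= r%:R -> `|t - t0| <= 1 -> `|y + t *: v| <= r.+1%:R.
Proof.
move=> v1 y0r tt0.
have -> : y + t *: v = (y + t0 *: v) + (t - t0) *: v.
  by rewrite -addrA -scalerDl [t0 + _]addrC subrK.
apply: le_trans (ler_normD _ _) _; rewrite -[r.+1%:R]natr1 lerD// normrZ -[leRHS]mul1r.
by apply: ler_pM => //; exact: unit_norm_le.
Qed.

(* The [m]-th point of the interval is rounded to a lattice of mesh
   [1 / (d.+1 * n ^ k)]; as some coordinate of [v] is at least [1 / d.+1], the
   rounded points are pairwise distinct. *)
Lemma lattice_near_line (r n k : nat) v y (a t0 : R) (Q : pred (@grid_index d.+1 r.+1 (d.+1 * n ^ k))) :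
  (0 < n)%N -> (0 < k)%N -> norm2 v = 1 ->
  a <= t0 <= a + n%:R^-1 -> `|y + t0 *: v| <= r%:R ->
  (forall t b, a <= t <= a + n%:R^-1 -> `|y + t *: v| <= r.+1%:R ->
     `|y + t *: v - @grid_point R _ _ _ b| <= (d.+1 * n ^ k)%:R^-1 -> Q b) ->
  (n ^ k.-1 <= #|Q|)%N.
Proof.
move=> n0 k0 v1 /andP[at0 t0a] y0r QP.
have n0R : 0 < n%:R :> R by rewrite ltr0n.
have nk0 : 0 < (n ^ k)%:R :> R by rewrite ltr0n expn_gt0 n0.
have h0 : (0 < d.+1 * n ^ k)%N by rewrite muln_gt0 expn_gt0 n0.
pose t (m : 'I_(n ^ k.-1)) := a + (m : nat)%:R / (n ^ k)%:R.
have tP m : a <= t m <= a + n%:R^-1.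
  rewrite lerDl divr_ge0//= lerD2l ler_pdivrMr// mulrC ler_pdivlMr//.
  have -> : (n ^ k = n ^ k.-1 * n)%N by rewrite -expnSr prednK.
  by rewrite -natrM ler_nat leq_mul2r (ltnW (ltn_ord m)) orbT.
(* The point at [t0] lies in the ball of radius [r] and the interval has length at most 1, which
   explains the radius [r.+1] of the lattice. *)
have xr m : `|y + t m *: v| <= r.+1%:R.
  apply: (@segment_norm_le r v y (t m) t0 v1 y0r).
  have n1 : n%:R^-1 <= 1 :> R by rewrite invf_le1// ler1n.
  have /andP[? ?] := tP m.
  by rewrite ler_norml; apply/andP; split; lra.
pose b m := grid_cell (d.+1 * n ^ k) (xr m).
have Qb m : Q (b m) by apply: QP (tP m) (xr m) _; exact: grid_cell_dist.
have [i vi] := unit_big_coord v1.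
have inj_b : injective b.
  move=> m m' /ffunP/(_ i)/(congr1 val); rewrite /b !ffunE/= !mxE => bE.
  apply/val_inj/eqP; apply: contraT => mm'.
  have x0 m0 : 0 <= ((y + t m0 *: v) 0 i + r.+1%:R) * (d.+1 * n ^ k)%:R.
    rewrite mulr_ge0//.
    by have := le_trans (normr_coord _ i) (xr m0); rewrite ler_norml => /andP[]; lra.
  have := truncn_dist (x0 m) (x0 m'); rewrite !mxE => /(_ bE); rewrite ltNge => /negP[].
  rewrite -mulrBl normrM [X in _ * X]ger0_norm// natrM.
  have -> : y 0 i + t m * v 0 i + r.+1%:R - (y 0 i + t m' * v 0 i + r.+1%:R) =
      ((m : nat)%:R - (m' : nat)%:R) / (n ^ k)%:R * v 0 i by rewrite /t; ring.
  rewrite !normrM normfV (gtr0_norm nk0).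
  have -> : `|(m : nat)%:R - (m' : nat)%:R| / (n ^ k)%:R * `|v 0 i| *
      (d.+1%:R * (n ^ k)%:R) = `|(m : nat)%:R - (m' : nat)%:R| * (d.+1%:R * `|v 0 i|) :> R.
    by field; rewrite gt_eqF.
  rewrite -[leLHS]mulr1; apply: ler_pM => //.
  have : (m != m' :> nat) := mm'.
  rewrite neq_ltn => /orP[]; rewrite -(ler_nat R) -natr1 => mm; last first.
    by apply: le_trans (ler_norm _); lra.
  by rewrite distrC; apply: le_trans (ler_norm _); lra.
rewrite -[leqLHS]card_ord -(card_codom inj_b); apply: subset_leq_card.
by apply/fintype.subsetP => c /codomP[m ->]; exact: Qb.
Qed.

End lines.

Section zeros_on_lines.
Context {R : realType} {d : nat}.
Implicit Types (x y v p : 'rV[R]_d.+1).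

(** On the line, the parameter of a point of the ball is a scalar product with [v], at most T =
    (d+1) r in absolute value. The pigeonhole principle is applied to 2 T n + 1 intervals of length
    1/n. *)
Lemma short_interval_zeros (r n k : nat) v y (S : set 'rV[R]_d.+1) :
  (0 < n)%N -> norm2 v = 1 -> perp v y ->
  (forall x, S x -> `|x| <= r%:R) ->
  ((((2 * (d.+1 * r) * n).+1 * k)%:R : R)%:E < counting (S `&` line v y))%E ->
  exists (a : R) (Z : seq R), [/\ sorted <%R Z, size Z = k.+1,
    all (fun t => a <= t <= a + n%:R^-1) Z & forall t, t \in Z -> S (y + t *: v)].
Proof.
move=> n0 v1 yv Sr /counting_gt_seq[s [us ks sS]].
have n0R : 0 < n%:R :> R by rewrite ltr0n.
pose T := (d.+1 * r)%N.
have xE x : x \in s -> x = y + dotv x v *: v.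
  by move=> /sS[_ [t _ <-]]; rewrite dotv_line.
pose Z0 := [seq dotv x v | x <- s].
have uZ0 : uniq Z0.
  rewrite map_inj_in_uniq// => x x' xs xs' h.
  by rewrite (xE _ xs) (xE _ xs') h.
have Z0S t : t \in Z0 -> S (y + t *: v).
  by move=> /mapP[x xs ->]; rewrite -xE//; case: (sS _ xs).
have Z0T t : t \in Z0 -> `|t| <= T%:R.
  move=> /mapP[x xs ->]; apply: le_trans (dotv_le _ v1) _.
  by rewrite natrM ler_wpM2l// Sr//; case: (sS _ xs).
have tT t : t \in Z0 -> 0 <= (t + T%:R) * n%:R.
  move=> /Z0T; rewrite ler_norml => /andP[h _].
  by rewrite mulr_ge0//; lra.
pose h (t : R) : 'I_(2 * T * n).+1 := inord (Num.truncn ((t + T%:R) * n%:R)).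
have hE t : t \in Z0 -> h t = Num.truncn ((t + T%:R) * n%:R) :> nat.
  move=> tZ; rewrite inordK// truncn_lt_nat ?tT//.
  rewrite -[ltRHS]natr1 natrM natrM ltr_pwDr// ler_wpM2r//.
  by have := Z0T _ tZ; rewrite ler_norml => /andP[_]; lra.
have [l kl] : exists l, (k < count (fun t => h t == l) Z0)%N.
  by apply: pigeonhole_count; rewrite size_map.
pose Z1 := sort <=%R [seq t <- Z0 | h t == l].
have sZ1 : sorted <%R Z1 by rewrite sort_lt_sorted filter_uniq.
have Z1Z0 t : t \in Z1 -> t \in Z0 /\ h t = l.
  by rewrite mem_sort mem_filter => /andP[/eqP].
exists (l%:R / n%:R - T%:R), (take k.+1 Z1); split.
- exact: take_sorted.
- by rewrite size_takel// size_sort size_filter.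
- apply/allP => t /mem_take/Z1Z0[tZ tl].
  have /andP[h1 h2] := truncn_itv (tT _ tZ).
  rewrite -(hE _ tZ) tl in h1 h2; rewrite -[X in _ < X]natr1 in h2.
  rewrite lerBlDr ler_pdivrMr// h1/= addrAC -{2}[n%:R^-1]mul1r -mulrDl.
  by rewrite lerBrDr ler_pdivlMr// ltW.
- by move=> t /mem_take/Z1Z0[tZ _]; exact: Z0S.
Qed.

(** With derivatives at most 3 n, the term [d.+1 ^ k] is the Rolle bound on an interval of length
    1/n, and the term 1 is the Lipschitz cost of moving to a lattice point, where the factor [d.+1]
    of the inverse mesh cancels the number of partial derivatives. *)
Definition small_value_bound (n k : nat) : R := 3 * (d.+1%:R ^+ k + 1) * n%:R / n%:R ^+ k.

(** A lattice point close to the line through [y] has a projection close to [y]; the box condition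
    records this and makes integration in [y] possible. Derivatives of order 1 serve the Lipschitz
    step, those of order [k] the Rolle step. *)
Lemma many_small_values (f : 'rV[R]_d.+1 -> R) (u : R) (K : set 'rV[R]_d.+1)
    (r n k : nat) v y (Q : pred (@grid_index d.+1 r.+1 (d.+1 * n ^ k))) :
  smooth f -> (0 < n)%N -> (0 < k)%N -> norm2 v = 1 -> perp v y ->
  (forall x, K x -> `|x| <= r%:R) ->
  (forall b, (forall s x, size s = 1%N \/ size s = k -> `|x| <= r.+1%:R ->
        `|pd s f x| <= 3 * n%:R) ->
      `|f (@grid_point R _ _ _ b) - u| <= small_value_bound n k ->
      box (proj v (@grid_point R _ _ _ b)) (d.+2%:R / (d.+1 * n ^ k)%:R) y -> Q b) ->
  (forall b, ~ (forall s x, size s = 1%N \/ size s = k -> `|x| <= r.+1%:R ->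
        `|pd s f x| <= 3 * n%:R) ->
      box (proj v (@grid_point R _ _ _ b)) (d.+2%:R / (d.+1 * n ^ k)%:R) y -> Q b) ->
  ((((2 * (d.+1 * r) * n).+1 * k)%:R : R)%:E < counting (level_set f u K `&` line v y))%E ->
  (n ^ k.-1 <= #|Q|)%N.
Proof.
move=> sf n0 k0 v1 yv Kr Qgood Qbad cN.
have n0R : 0 < n%:R :> R by rewrite ltr0n.
have h0 : (0 < d.+1 * n ^ k)%N by rewrite muln_gt0 expn_gt0 n0.
have [a [Z [sZ kZ aZ ZS]]] := short_interval_zeros n0 v1 yv (fun x (h : level_set f u K x) => Kr x h.1) cN.
have [t0 t0Z] : exists t0, t0 \in Z by case: (Z) kZ => // t0 Z' _; exists t0; rewrite mem_head.
have t0a := allP aZ _ t0Z.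
apply: (@lattice_near_line _ _ r n k v y a t0) => //.
  by apply: Kr; case: (ZS _ t0Z).
move=> t b ta xr xb; set x := y + t *: v in xr xb.
have yb : box (proj v (@grid_point R _ _ _ b)) (d.+2%:R / (d.+1 * n ^ k)%:R) y.
  have hp : `|proj v x - proj v (@grid_point R _ _ _ b)| <= d.+2%:R / (d.+1 * n ^ k)%:R.
    by rewrite projB; apply: le_trans (proj_le _ v1) _; rewrite ler_wpM2l.
  rewrite /x proj_line// in hp.
  move=> i; apply: le_trans hp.
  have := normr_coord (y - proj v (@grid_point R _ _ _ b)) i.
  by rewrite 2!mxE.
have [good|bad] := pselect (forall s x, size s = 1%N \/ size s = k ->
  `|x| <= r.+1%:R -> `|pd s f x| <= 3 * n%:R); last exact: Qbad.
apply: Qgood => //.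
have n30 : 0 <= 3 * n%:R :> R by rewrite mulr_ge0.
have lip : `|f (@grid_point R _ _ _ b) - f x| <= 3 * n%:R / n%:R ^+ k.
  have := @smooth_lipschitz_bound _ _ f r.+1%:R (3 * n%:R) sf
    (fun i z zr => good [:: i] z (or_introl erefl) zr) _ _ (grid_point_norm b h0) xr.
  move/le_trans; apply; rewrite distrC.
  apply: le_trans (ler_wpM2l _ xb) _; first by rewrite mulr_ge0.
  rewrite natrM natrX; have : n%:R ^+ k != 0 :> R by rewrite expf_neq0// gt_eqF.
  have : d.+1%:R != 0 :> R by [].
  move: (d.+1%:R) (n%:R ^+ k) => D N D0 N0.
  by rewrite le_eqVlt; apply/orP; left; apply/eqP; field; rewrite N0.
have zer : `|f x - u| <= (a + n%:R^-1 - a) ^+ k * (d.+1%:R ^+ k * (3 * n%:R)).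
  apply: (@line_zeros_small _ _ f y v u a (a + n%:R^-1) (3 * n%:R) k (take k Z)) => //.
  - by move=> i; exact: unit_coord.
  - exact: take_sorted.
  - by rewrite size_takel// kZ.
  - by apply/allP => s /mem_take/ZS[_ ->].
  - by apply/allP => s /mem_take/(allP aZ).
  - move=> s t' sk t'a; apply: good; first by right.
    apply: (@segment_norm_le _ _ r v y t' t0) => //; first by apply: Kr; case: (ZS _ t0Z).
    have n1 : n%:R^-1 <= 1 :> R by rewrite invf_le1// ler1n.
    move: t0a t'a => /andP[? ?] /andP[? ?].
    by rewrite ler_norml; apply/andP; split; lra.
rewrite (_ : a + n%:R^-1 - a = n%:R^-1) in zer; last by ring.
apply: le_trans (_ : `|f (@grid_point R _ _ _ b) - f x| + `|f x - u| <= _).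
  by rewrite -[X in `|X|](subrKA (f x)) ler_normD.
rewrite /small_value_bound; apply: le_trans (lerD lip zer) _.
by rewrite exprVn le_eqVlt; apply/orP; left; apply/eqP; ring.
Qed.

End zeros_on_lines.

(* The integral of a nonnegative function is a supremum over the simple functions
   below it, whether or not the function is measurable. *)
Lemma le_integral_nonmeasurable disp (T : measurableType disp) (R : realType)
    (mu : {measure set T -> \bar R}) (D : set T) (f g : T -> \bar R) :
  (forall x, D x -> 0 <= f x)%E -> (forall x, D x -> f x <= g x)%E ->
  (\int[mu]_(x in D) f x <= \int[mu]_(x in D) g x)%E.
Proof.
move=> f0 fg.
have g0 x : D x -> (0 <= g x)%E by move=> Dx; exact: le_trans (f0 x Dx) (fg x Dx).
rewrite !ge0_integralE//; apply: ge_ereal_sup => _ [h hf <-].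
apply: ereal_sup_ubound; exists h => // x.
apply: le_trans (hf x) _; rewrite /patch; case: ifPn => // xD.
by apply: fg; rewrite inE in xD.
Qed.

(** The bound is first proved for [N] truncated at [c J]; since [c] is unbounded, letting J grow
    also covers an infinite [N]. *)
Lemma le_dyadic_levels (R : realType) (N : \bar R) (c : nat -> nat) :
  (forall j, c j <= c j.+1)%N -> (forall j, j <= c j)%N ->
  (N <= (c 0%N)%:R%:E * (0%:E < N)%E%:R%:E +
    \sum_(0 <= j <oo) ((c j.+1)%:R * ((c j)%:R%:E < N)%E%:R)%:E)%E.
Proof.
move=> cm cj; pose t j := (((c j.+1)%:R * (((c j)%:R : R)%:E < N)%E%:R : R)%:E).
have t0 j : (0 <= t j)%E by rewrite lee_fin mulr_ge0.
have [N0|N0] := leP N 0%E.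
  apply: le_trans N0 _; rewrite adde_ge0 ?mule_ge0 ?lee_fin//.
  by apply: nneseries_ge0 => *; exact: t0.
rewrite mule1.
have part J : (Order.min N (c J)%:R%:E <= (c 0%N)%:R%:E + \sum_(0 <= j < J) t j)%E.
  elim: J => [|J ih]; first by rewrite big_nil adde0 ge_min lexx orbT.
  rewrite big_nat_recr//= addeA; have [NJ|NJ] := leP N (c J)%:R%:E.
    rewrite min_l in ih => //; apply: le_trans (_ : (N <= _)%E).
      by rewrite ge_min lexx.
    by apply: le_trans ih _; rewrite leeDl// t0.
  rewrite ge_min; apply/orP; right; rewrite {2}/t NJ mulr1.
  rewrite leeDr// adde_ge0 ?lee_fin//; apply: sume_ge0 => j _; exact: t0.
have lim J : (Order.min N (c J)%:R%:E <= (c 0%N)%:R%:E + \sum_(0 <= j <oo) t j)%E.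
  by apply: le_trans (part J) _; rewrite leeD2l// nneseries_lim_ge.
case: N => [x||] in N0 t t0 part lim *.
- have := lim (Num.truncn x).+1; rewrite min_l// lee_fin.
  have /andP[_ h] := truncn_itv (ltW N0 : 0 <= x).
  by apply: le_trans (ltW h) _; rewrite ler_nat cj.
- set S := (X in (_ <= X)%E) in lim *; suff -> : S = +oo%E by [].
  apply/eqyP => A A0; apply: le_trans (lim (Num.truncn A).+1).
  rewrite min_r ?leey// lee_fin.
  have /andP[_ h] := truncn_itv (ltW A0).
  by apply: le_trans (ltW h) _; rewrite ler_nat cj.
- by [].
Qed.

Lemma counting_ge0 (R : realType) (T : choiceType) (A : set T) :
  (0 <= counting A :> \bar R)%E.
Proof. by rewrite /counting; case: ifPn => // _; rewrite lee_fin. Qed.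

Lemma integral_geometric_ge0 (R : realType) (d : nat) (B : set 'rV[R]_d.+1) :
  (0 <= integral_geometric B)%E.
Proof.
apply: mule_ge0; first by rewrite lee_fin divr_ge0 ?Gamma_ge0// mulr_ge0// powR_ge0.
by apply: integral_ge0 => v _; apply: integral_ge0 => y _; exact: counting_ge0.
Qed.

(** * From lattice points to the integral geometric measure *)

Section level_set_measure.
Context {R : realType} {d : nat}.
Variables (f : 'rV[R]_d.+1 -> R) (u : R) (K : set 'rV[R]_d.+1) (r k : nat).
Hypotheses (sf : smooth f) (r0 : (0 < r)%N) (k0 : (0 < k)%N).
Hypothesis Kr : forall x, K x -> `|x| <= r%:R.

Local Notation index j := (@grid_index d.+1 r.+1 (d.+1 * (2 ^ j) ^ k)).

Definition derivatives_bounded (j : nat) := forall s x, size s = 1%N \/ size s = k ->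
  `|x| <= r.+1%:R -> `|pd s f x| <= 3 * (2 ^ j)%:R.

(* At level [j] every lattice point is bad when the derivatives are too large. *)
Variable bad : forall j, pred (index j).
Hypothesis badP : forall j (b : index j),
  (derivatives_bounded j -> `|f (grid_point b) - u| <= @small_value_bound R d (2 ^ j) k) ->
  bad b.

Let c (j : nat) : nat := ((2 * (d.+1 * r) * 2 ^ j).+1 * k)%N.
Let N v y : \bar R := counting (level_set f u K `&` line v y).
Let h (j : nat) : nat := (d.+1 * (2 ^ j) ^ k)%N.

Let h0 j : (0 < h j)%N.
Proof. by rewrite muln_gt0/= !expn_gt0. Qed.

Let CH : R := hausdorff_const R d * (4 * d.+1%:R ^+ 3) ^+ d.

Let Y v j (b : index j) : set (borelRd R d.+1) := @box R d (proj v (grid_point b)) (d.+2%:R / (h j)%:R : R).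

(** The normalization by n^(k-1) with n = 2^j makes [g] at least [c j.+1] as soon as [y] lies in the
    boxes of n^(k-1) bad points. *)
Let g v j (y : borelRd R d.+1) : \bar R :=
  (((c j.+1)%:R / ((2 ^ j) ^ k.-1)%:R)%:E *
    \sum_(b <- enum (@bad j)) (\1_(Y v b) y)%:E)%E.

Let measurable_box (p : 'rV[R]_d.+1) (rho : R) : measurable (box p rho).
Proof. by apply: closed_borel; exact: box_closed. Qed.

Lemma line_count_le v y : norm2 v = 1 -> perp v y ->
  (N v y <= (c 0)%:R%:E * (\1_(box 0 (d.+2%:R * r%:R)) y)%:E +
    \sum_(0 <= j <oo) g v j y)%E.
Proof.
move=> v1 yv.
apply: le_trans (@le_dyadic_levels R (N v y) c _ _) _.
- by move=> j; rewrite /c expnS leq_mul2r ltnS !leq_mul2l leq_pmull ?orbT.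
- move=> j; rewrite /c; apply: leq_trans (leq_pmulr _ k0).
  apply: leqW; apply: leq_trans (ltnW (ltn_expl j (isT : 1 < 2)%N)) _.
  by rewrite leq_pmull// !muln_gt0.
apply: leeD.
  (* If the line meets the level set, [y] is the projection of a point of [K] and so lies in a fixed
     box. *)
  rewrite lee_wpmul2l// lee_fin indicE.
  have [N0|//] := boolP (0%:E < N v y)%E; rewrite mem_set//=.
  have [s [_ s0 sN]] := @counting_gt_seq R _ _ 0 N0.
  case: s s0 sN => // x s _ /(_ x (mem_head _ _))[[Kx _] [t _ xE]] i.
  rewrite mxE subr0 -(proj_line t v1 yv) xE; apply: le_trans (normr_coord _ i) _.
  by apply: le_trans (proj_le _ v1) _; rewrite ler_wpM2l// Kr.
apply: lee_nneseries => j _; first by move=> _; rewrite lee_fin mulr_ge0.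
rewrite /g sumEFin -EFinM lee_fin -mulrA ler_wpM2l//.
have [Nc|_] := boolP ((c j)%:R%:E < N v y)%E; last first.
  by rewrite mulr_ge0 ?invr_ge0// sumr_ge0.
pose Q := [pred b : index j | bad b && `[< Y v b y >]].
have nQ : ((2 ^ j) ^ k.-1 <= #|Q|)%N.
  apply: (@many_small_values _ _ f u K r (2 ^ j) k v y Q) => //.
  - by rewrite expn_gt0.
  - by move=> b db fb Yb; rewrite /Q/= badP//; exact/asboolP.
  - move=> b db Yb; rewrite /Q/= badP; first exact/asboolP.
    by move=> /db.
rewrite mulrC ler_pdivlMr ?ltr0n ?expn_gt0// mul1r.
rewrite big_enum/=; apply: (@le_trans _ _ #|Q|%:R); first by rewrite ler_nat.
rewrite -sum1_card natr_sum big_mkcondr/=; apply: ler_sum => b _.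
by rewrite indicE; case: asboolP => // Yb; rewrite mem_set.
Qed.

Let g0 v j y : (0 <= g v j y)%E.
Proof.
rewrite mule_ge0// ?lee_fin ?divr_ge0//.
by apply: sume_ge0 => b _; rewrite lee_fin.
Qed.

Let mindic (p : 'rV[R]_d.+1) (rho : R) (D : set (borelRd R d.+1)) :
  measurable_fun D (fun y => (\1_(box p rho) y)%:E : \bar R).
Proof. by apply/measurable_EFinP/measurable_funTS; exact: measurable_indic. Qed.

Let mg v j (D : set (borelRd R d.+1)) : measurable_fun D (g v j).
Proof.
apply: emeasurable_funM => //; apply: emeasurable_sum => b.
exact: mindic.
Qed.

Lemma integral_line_count v : norm2 v = 1 ->
  (\int[hausdorff d]_(y in perp v) N v y <=
     ((c 0)%:R * (CH * (d.+2%:R * r%:R) ^+ d))%:E +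
     \sum_(0 <= j <oo) ((c j.+1)%:R / ((2 ^ j) ^ k.-1)%:R *
        (#|@bad j|%:R * (CH * (d.+2%:R / (h j)%:R) ^+ d)))%:E)%E.
Proof.
move=> v1.
have mperp : measurable (perp v : set (borelRd R d.+1)).
  by apply: closed_borel; exact: perp_closed.
have N0 y : perp v y -> (0 <= N v y)%E.
  by move=> _; exact: counting_ge0.
apply: le_trans (@le_integral_nonmeasurable _ (borelRd R d.+1) R (hausdorff d)
  (perp v) (N v) _ N0 (fun y => line_count_le v1)) _.
have G1 y : perp v y -> (0 <= (c 0)%:R%:E * (\1_(box 0 (d.+2%:R * r%:R)) y)%:E :> \bar R)%E.
  by move=> _; rewrite mule_ge0 ?lee_fin.
have mG1 : measurable_fun (perp v : set (borelRd R d.+1))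
    (fun y => (c 0)%:R%:E * (\1_(box 0 (d.+2%:R * r%:R)) y)%:E : \bar R)%E.
  by apply: emeasurable_funM => //; exact: mindic.
have G2 y : perp v y -> (0 <= \sum_(0 <= j <oo) g v j y)%E.
  by move=> _; apply: nneseries_ge0 => j _ _; exact: g0.
have mG2 : measurable_fun (perp v : set (borelRd R d.+1))
    (fun y => \sum_(0 <= j <oo) g v j y)%E.
  by apply: ge0_emeasurable_sum => [j y _ _|j _]; [exact: g0|exact: mg].
rewrite ge0_integralD//.
apply: leeD.
  rewrite ge0_integralZl_EFin//.
  rewrite integral_indic// EFinM lee_wpmul2l// setIC.
  by apply: hausdorff_perp_box; rewrite // mulr_gt0// ltr0n.
rewrite integral_nneseries//.
apply: lee_nneseries => j _; first by move=> _; apply: integral_ge0.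
rewrite ge0_integralZl_EFin ?divr_ge0//; last 2 first.
- by move=> y _; apply: sume_ge0 => b _; rewrite lee_fin.
- by apply: emeasurable_sum => b; exact: mindic.
rewrite [leRHS]EFinM lee_wpmul2l ?lee_fin ?divr_ge0//.
rewrite ge0_integral_sum//; last first.
  by move=> b; exact: mindic.
apply: (@le_trans _ _ (\sum_(b <- enum (@bad j)) (CH * (d.+2%:R / (h j)%:R) ^+ d)%:E)%E).
  apply: lee_sum => b _; have mY : measurable (Y v b) by exact: measurable_box.
  rewrite integral_indic// setIC.
  by apply: hausdorff_perp_box => //; rewrite divr_gt0// ltr0n.
by rewrite sumEFin lee_fin big_const_seq count_predT iter_addr_0 -cardE [leRHS]mulr_natl.
Qed.

Let CH0 : 0 <= CH.
Proof. by rewrite mulr_ge0 ?hausdorff_const_ge0// exprn_ge0// mulr_ge0// exprn_ge0. Qed.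

(** Here [c j.+1] is of order 2^j, and replacing the power [d] of [h] by [d.+1] costs a factor h, of
    which h / (2^j)^(k-1) = (d+1) 2^j remains. *)
Let level_coef j : (c j.+1)%:R / ((2 ^ j) ^ k.-1)%:R *
    (#|@bad j|%:R * (CH * (d.+2%:R / (h j)%:R) ^+ d)) <=
  (4 * (d.+1 * r)%:R + 1) * k%:R * d.+1%:R * d.+2%:R ^+ d * CH *
    (4 ^+ j * (#|@bad j|%:R / (h j)%:R ^+ d.+1)) :> R.
Proof.
have n0 : 0 < 2 ^+ j :> R by rewrite exprn_gt0.
have hr0 : 0 < (h j)%:R :> R by rewrite ltr0n.
have cle : (c j.+1)%:R <= (4 * (d.+1 * r)%:R + 1) * k%:R * 2 ^+ j :> R.
  rewrite /c natrM mulrAC ler_wpM2r//.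
  have -> : (2 * (d.+1 * r) * 2 ^ j.+1).+1%:R = 4 * (d.+1 * r)%:R * 2 ^+ j + 1 :> R.
    by rewrite -[LHS]natr1 natrM natrM natrX exprS; ring.
  by rewrite [leRHS]mulrDl mul1r lerD2l exprn_ege1// ler1n.
have hE : (h j)%:R = d.+1%:R * (2 ^+ j * (2 ^+ j) ^+ k.-1) :> R.
  by rewrite /h natrM !natrX -exprS prednK.
rewrite natrX natrX expr_div_n.
have -> : (#|@bad j|%:R * (CH * (d.+2%:R ^+ d / (h j)%:R ^+ d))) =
   #|@bad j|%:R * CH * d.+2%:R ^+ d / (h j)%:R ^+ d.+1 * (h j)%:R :> R.
  by rewrite exprS; field; rewrite expf_neq0 ?gt_eqF.
rewrite {2}hE.
have W0 : 0 <= #|@bad j|%:R * CH * d.+2%:R ^+ d / (h j)%:R ^+ d.+1 * d.+1%:R * 2 ^+ j :> R.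
  by rewrite mulr_ge0 ?(ltW n0)// mulr_ge0// divr_ge0 ?exprn_ge0// mulr_ge0 ?exprn_ge0// mulr_ge0.
apply: le_trans (_ : _ <= (c j.+1)%:R * (#|@bad j|%:R * CH * d.+2%:R ^+ d /
    (h j)%:R ^+ d.+1 * d.+1%:R * 2 ^+ j)) _.
  rewrite le_eqVlt; apply/orP; left; apply/eqP; field.
  by rewrite expf_neq0 ?gt_eqF// ?exprn_gt0.
apply: le_trans (ler_wpM2r W0 cle) _.
rewrite (_ : 4 ^+ j = 2 ^+ j * 2 ^+ j); last by rewrite -exprMn; congr (_ ^+ j); ring.
by rewrite le_eqVlt; apply/orP; left; apply/eqP; ring.
Qed.

(** It depends on neither [f] nor [u], so the same constant serves all sample paths. *)
Definition level_set_const : R := Gamma (d.+2%:R / 2) / (2 * pi `^ (d%:R / 2)) *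
  (fine (hausdorff d (@sphere R d.+1)) *
    ((c 0)%:R * (CH * (d.+2%:R * r%:R) ^+ d) +
     (4 * (d.+1 * r)%:R + 1) * k%:R * d.+1%:R * d.+2%:R ^+ d * CH)).

Lemma level_set_const_ge0 : 0 <= level_set_const.
Proof.
apply: mulr_ge0; first by rewrite divr_ge0 ?Gamma_ge0// mulr_ge0// powR_ge0.
apply: mulr_ge0; first by apply: fine_ge0; exact: measure_ge0.
apply: addr_ge0; first by rewrite mulr_ge0// mulr_ge0// exprn_ge0// mulr_ge0.
by rewrite mulr_ge0// mulr_ge0 ?exprn_ge0// mulr_ge0// mulr_ge0// addr_ge0// mulr_ge0.
Qed.

Lemma integral_geometric_le :
  (integral_geometric (level_set f u K) <= level_set_const%:E * (1 +
     \sum_(0 <= j <oo) (4 ^+ j * (#|@bad j|%:R / (h j)%:R ^+ d.+1))%:E))%E.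
Proof.
pose A0 : R := (c 0)%:R * (CH * (d.+2%:R * r%:R) ^+ d).
pose A1 : R := (4 * (d.+1 * r)%:R + 1) * k%:R * d.+1%:R * d.+2%:R ^+ d * CH.
have A00 : 0 <= A0 by rewrite mulr_ge0// mulr_ge0// exprn_ge0// mulr_ge0.
have A10 : 0 <= A1.
  by rewrite mulr_ge0// mulr_ge0 ?exprn_ge0// mulr_ge0// mulr_ge0// addr_ge0// mulr_ge0.
pose S : \bar R := (\sum_(0 <= j <oo) (4 ^+ j * (#|@bad j|%:R / (h j)%:R ^+ d.+1))%:E)%E.
have t0 j : (0 <= (4 ^+ j * (#|@bad j|%:R / (h j)%:R ^+ d.+1))%:E :> \bar R)%E.
  by rewrite lee_fin mulr_ge0 ?exprn_ge0// divr_ge0// exprn_ge0.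
have S0 : (0 <= S)%E by apply: nneseries_ge0 => *; exact: t0.
have Ile v : norm2 v = 1 ->
    (\int[hausdorff d]_(y in perp v) N v y <= (A0 + A1)%:E * (1 + S))%E.
  move=> v1; apply: le_trans (integral_line_count v1) _.
  rewrite ge0_muleDr// mule1; apply: leeD.
    by rewrite lee_fin lerDl.
  rewrite /S -nneseriesZl; last by move=> *; exact: t0.
  apply: lee_nneseries => j _.
    move=> _; have e0 : 0 <= CH * (d.+2%:R / (h j)%:R) ^+ d.
      by rewrite mulr_ge0// exprn_ge0// divr_ge0.
    by rewrite lee_fin mulr_ge0 ?divr_ge0// mulr_ge0.
  rewrite -EFinM lee_fin; apply: le_trans (level_coef j) _; rewrite -/A1.
  have := t0 j; rewrite lee_fin => tj.
  by rewrite ler_wpM2r// lerDr.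
have msph : measurable (@sphere R d.+1).
  by apply: closed_borel; exact: sphere_closed.
have Hs := @hausdorff_sphere R d.
have Hs0 : (0 <= hausdorff d (@sphere R d.+1))%E by exact: measure_ge0.
pose C : R := Gamma (d.+2%:R / 2) / (2 * pi `^ (d%:R / 2)).
have C0 : 0 <= C by rewrite divr_ge0 ?Gamma_ge0// mulr_ge0// powR_ge0.
rewrite /level_set_const -/A0 -/A1 -/C.
rewrite /integral_geometric [X in (_ <= X * _)%E]EFinM -[leRHS]muleA.
apply: lee_wpmul2l; rewrite ?lee_fin//.
have N0 v : sphere v -> (0 <= \int[hausdorff d]_(y in perp v) N v y)%E.
  move=> _; apply: integral_ge0 => y _.
  exact: counting_ge0.
apply: le_trans (@le_integral_nonmeasurable _ (borelRd R d.+1) R (hausdorff d)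
  (@sphere R d.+1) _ (fun=> (A0 + A1)%:E * (1 + S))%E N0 (fun v => @Ile v)) _.
rewrite integral_cst// EFinM fineK; last by rewrite ge0_fin_numE.
by rewrite muleC muleA.
Qed.

End level_set_measure.

(** * Moments *)

Lemma le_expe (R : realType) (x y : \bar R) (m : nat) :
  (0 <= x)%E -> (x <= y)%E -> (x ^+ m <= y ^+ m)%E.
Proof.
move=> x0 xy; elim: m => [|m ih]; first by rewrite !expe0.
by rewrite !expeS; apply: lee_pmul => //; exact: expe_ge0.
Qed.

Lemma expe_EFinM (R : realType) (a : R) (x : \bar R) (m : nat) :
  ((a%:E * x) ^+ m = (a ^+ m)%:E * x ^+ m)%E.
Proof.
elim: m => [|m ih]; first by rewrite !expe0 mule1 expr0.
by rewrite !expeS ih exprS EFinM muleACA.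
Qed.

(** Let s be the sum on the right. Then V_j^m <= C^(m-1) V_j <= C^(m-1) s / 8^(j m), so V_j <= a /
    8^j with a^m = C^(m-1) s, and the sum of 4^j V_j is at most 2 a. *)
Lemma series_moment (R : realType) (V : nat -> R) (C : R) (m : nat) :
  (0 < m)%N -> 0 < C -> (forall j, 0 <= V j <= C) ->
  ((1 + \sum_(0 <= j <oo) (4 ^+ j * V j)%:E) ^+ m <=
   (2 ^+ m)%:E + (4 ^+ m * C ^+ m.-1)%:E *
     \sum_(0 <= j <oo) ((8 ^+ j) ^+ m * V j)%:E)%E.
Proof.
move=> m0 C0 VC.
have V0 j : 0 <= V j by case/andP: (VC j).
set S := (\sum_(0 <= j <oo) ((8 ^+ j) ^+ m * V j)%:E)%E.
have t0 j : (0 <= ((8 ^+ j) ^+ m * V j)%:E :> \bar R)%E.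
  by rewrite lee_fin mulr_ge0// !exprn_ge0.
have S0 : (0 <= S)%E by apply: nneseries_ge0 => *; exact: t0.
have C4 : 0 < 4 ^+ m * C ^+ m.-1 by rewrite mulr_gt0 ?exprn_gt0.
have [->|Sfin] := eqVneq S +oo%E.
  by rewrite gt0_muley ?lte_fin// addey// leey.
have {}Sfin : S \is a fin_num by rewrite ge0_fin_numE// lt_neqAle Sfin leey.
set s := fine S; have sE : S = s%:E by rewrite fineK.
have s0 : 0 <= s by exact: fine_ge0.
have Vs j : (8 ^+ j) ^+ m * V j <= s.
  rewrite -lee_fin -sE.
  apply: le_trans (_ : (\sum_(0 <= i < j.+1) ((8 ^+ i) ^+ m * V i)%:E <= S)%E).
    by rewrite big_nat_recr//= leeDr// sume_ge0.
  exact: nneseries_lim_ge.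
pose a := (C ^+ m.-1 * s) `^ (m%:R^-1).
have am : a ^+ m = C ^+ m.-1 * s.
  rewrite -powR_mulrn ?powR_ge0// -powRrM mulVf ?pnatr_eq0 -?lt0n// powRr1//.
  by rewrite mulr_ge0// exprn_ge0// ltW.
have a0 : 0 <= a by exact: powR_ge0.
have Va j : V j <= a / 8 ^+ j.
  have e0 : 0 < 8 ^+ j :> R by rewrite exprn_gt0.
  rewrite ler_pdivlMr// -(@ler_pXn2r _ m)// ?nnegrE ?mulr_ge0// ?(ltW e0)//.
  rewrite am exprMn; have -> : V j ^+ m = V j ^+ m.-1 * V j by rewrite -exprSr prednK.
  rewrite -mulrA; apply: ler_pM.
  - by rewrite exprn_ge0.
  - by rewrite mulr_ge0// !exprn_ge0.
  - by case/andP: (VC j) => _ VC'; apply: lerXn2r; rewrite ?nnegrE// ltW.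
  - by rewrite mulrC.
have sum4 : (\sum_(0 <= j <oo) (4 ^+ j * V j)%:E <= (a * (1 - 2^-1)^-1)%:E)%E.
  apply: nneseries_geometric_le => //.
  - by rewrite invf_lt1// ltr1n.
  - by move=> j; rewrite lee_fin mulr_ge0// exprn_ge0.
  move=> j; rewrite lee_fin.
  apply: le_trans (ler_wpM2l _ (Va j)) _; first by rewrite exprn_ge0.
  rewrite mulrCA ler_wpM2l// ler_pdivrMr ?exprn_gt0// -exprMn.
  by rewrite (_ : 2^-1 * 8 = 4 :> R)//; field.
apply: le_trans (le_expe m (y := (1 + 2 * a)%:E) _ _) _.
- by rewrite adde_ge0// nneseries_ge0// => j _ _; rewrite lee_fin mulr_ge0// exprn_ge0.
- rewrite EFinD leeD2l//; apply: le_trans sum4 _; rewrite lee_fin.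
  by rewrite (_ : (1 - 2^-1)^-1 = 2 :> R) 1?mulrC//; field.
rewrite sE -EFin_expe -EFinM -EFinD lee_fin -mulrA -am -exprMn.
(* In the first case (1 + 2a)^m is at most 2^m, in the second at most (4a)^m. *)
have [a1|a1] := leP (2 * a) 1.
  rewrite -[leLHS]addr0 lerD ?exprn_ge0 ?mulr_ge0//.
  by apply: lerXn2r; rewrite ?nnegrE ?addr_ge0 ?mulr_ge0//; lra.
rewrite -[leLHS]add0r lerD ?exprn_ge0//.
by apply: lerXn2r; rewrite ?nnegrE ?addr_ge0 ?mulr_ge0//; lra.
Qed.

Section moments.
Context disp (T : measurableType disp) (R : realType) (P : probability T R).
Context (d : nat) (X : 'rV[R]_d.+1 -> T -> R).
Hypothesis mX : forall t, measurable_fun setT (X t).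
Hypothesis gX : forall (n : nat) (t : 'I_n -> 'rV[R]_d.+1) (a : 'I_n -> R),
  is_gaussian P (fun w => \sum_(i < n) a i * X (t i) w).
Hypothesis sX : forall w, smooth (fun t => X t w).
Variables (kappa : R) (kappa0 : 0 < kappa).
Hypothesis kX : forall t, (kappa%:E < variance P (X t))%E.
Variables (u : R) (m r : nat) (m0 : (0 < m)%N) (r0 : (0 < r)%N).
Variable K : set 'rV[R]_d.+1.
Hypothesis Kr : forall x, K x -> `|x| <= r%:R.

(** Small values are then of order n^(1-k) = n^(-3m-1), one power of n = 2^j beyond the weight 8^(j
    m) = n^(3m). *)
Let k : nat := (3 * m).+2.
Let h (j : nat) : nat := (d.+1 * (2 ^ j) ^ k)%N.
Local Notation index j := (@grid_index d.+1 r.+1 (d.+1 * (2 ^ j) ^ k)).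

(** Each bad event is the union of a small-value event for its own lattice point and of two events
    shared by the whole level, outside which the derivatives of order 1 and [k] are bounded. It is
    thus a measurable set containing the required outcomes. *)
Lemma bad_events : exists2 C : R, 0 <= C & exists A : forall j, index j -> set T,
  (forall j b, measurable (@A j b)) /\
  (forall j b, (P (@A j b) <= (C / (2 ^+ j) ^+ (3 * m).+1)%:E)%E) /\
  (forall w j (b : index j), (derivatives_bounded (fun t => X t w) r k j ->
     `|X (grid_point b) w - u| <= @small_value_bound R d (2 ^ j) k) -> A j b w).
Proof.
have [C1 C10 h1] := pd_sup_tail_uniform mX gX sX r.+1 (3 * m).+1 1.
have [C2 C20 h2] := pd_sup_tail_uniform mX gX sX r.+1 (3 * m).+1 k.
have [C3 C30 h3] := gaussian_small_ball P kappa0.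
have n1 j : 1 <= 2 ^+ j :> R by rewrite exprn_ege1// ler1n.
have n0 j : 0 < 2 ^+ j :> R by rewrite exprn_gt0.
pose Q1 (n : nat) (C : R) j (B : set T) :=
  (measurable B /\ (P B <= (C / (2 ^+ j) ^+ (3 * m).+1)%:E)%E) /\
    forall w, ~ B w -> forall s x, size s = n -> `|x| <= r.+1%:R ->
      `|pd s (fun t => X t w) x| <= 3 * 2 ^+ j.
have [B1 B1P] := @choice _ _ (Q1 1%N C1) (fun j =>
  let: ex_intro2 B mB BP := h1 (2 ^+ j) (n1 j) in ex_intro _ B (conj mB BP)).
have [B2 B2P] := @choice _ _ (Q1 k C2) (fun j =>
  let: ex_intro2 B mB BP := h2 (2 ^+ j) (n1 j) in ex_intro _ B (conj mB BP)).
pose E j (b : index j) := [set w | `|X (grid_point b) w - u| <= @small_value_bound R d (2 ^ j) k].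
have gXt t : is_gaussian P (X t).
  have := gX (fun _ : 'I_1 => t) (fun=> 1); congr (is_gaussian _ _).
  by apply/funext => w; rewrite big_ord1 mul1r.
have mE j b : measurable (E j b).
  apply: measurable_set_ler => //; apply: measurableT_comp => //.
  exact: measurable_funB.
have sv0 j : 0 <= @small_value_bound R d (2 ^ j) k.
  by rewrite /small_value_bound divr_ge0 ?exprn_ge0// mulr_ge0// mulr_ge0// addr_ge0// exprn_ge0.
have svE j : @small_value_bound R d (2 ^ j) k = 3 * (d.+1%:R ^+ k + 1) / (2 ^+ j) ^+ (3 * m).+1.
  rewrite /small_value_bound natrX /k [X in _ / X]exprS; field.
  by rewrite !expf_neq0.
pose C := C1 + C2 + C3 * (3 * (d.+1%:R ^+ k + 1)).
exists C.
  by rewrite addr_ge0 ?addr_ge0// mulr_ge0// mulr_ge0// addr_ge0// exprn_ge0.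
exists (fun j b => B1 j `|` B2 j `|` E j b); split; [|split] => [j b|j b|w j b].
- apply: measurableU => //; apply: measurableU; [exact: (B1P j).1.1|exact: (B2P j).1.1].
- have m1 := (B1P j).1.1; have m2 := (B2P j).1.1.
  apply: le_trans (measureU2 _ _ _) _ => //; first exact: measurableU.
  rewrite /C mulrDl EFinD; apply: leeD.
    apply: le_trans (measureU2 _ _ _) _ => //.
    by rewrite mulrDl EFinD; apply: leeD; [exact: (B1P j).1.2|exact: (B2P j).1.2].
  by rewrite -mulrA -svE; exact: h3.
- move=> wb; have [b1|nb1] := pselect (B1 j w); first by left; left.
  have [b2|nb2] := pselect (B2 j w); first by left; right.
  right; apply: wb => s x [sn|sn] xr; rewrite natrX.
    exact: (B1P j).2.
  exact: (B2P j).2.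
Qed.

Lemma level_set_moment :
  (\int[P]_w (integral_geometric (level_set (fun t => X t w) u K) ^+ m) < +oo)%E.
Proof.
have [C C0 [A [mA [PA AP]]]] := bad_events.
pose bad w j : pred (index j) := fun b => w \in A j b.
have badP w j (b : index j) : (derivatives_bounded (fun t => X t w) r k j ->
     `|X (grid_point b) w - u| <= @small_value_bound R d (2 ^ j) k) -> bad w j b.
  by move=> /AP; rewrite /bad inE.
have h0 j : 0 < (h j)%:R :> R by rewrite ltr0n muln_gt0/= !expn_gt0.
pose V w j : R := #|@bad w j|%:R / (h j)%:R ^+ d.+1.
pose W : R := (2 * r.+1%:R + 1) ^+ d.+1.
have W0 : 0 < W by rewrite exprn_gt0.
have cardW j : #|{: index j}|%:R / (h j)%:R ^+ d.+1 <= W.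
  rewrite ler_pdivrMr ?exprn_gt0// card_ffun !card_ord natrX /W -exprMn.
  apply: lerXn2r; rewrite ?nnegrE ?mulr_ge0 ?addr_ge0 ?mulr_ge0//.
  rewrite -/(h j) -[leLHS]natr1 natrM natrM [leRHS]mulrDl mul1r lerD2l.
  by rewrite ler1n -(ltr0n R).
have VW w j : 0 <= V w j <= W.
  rewrite divr_ge0 ?exprn_ge0//=; apply: le_trans (cardW j).
  by rewrite ler_wpM2r ?invr_ge0 ?exprn_ge0// ler_nat max_card.
have VE w j : V w j = \sum_(b : index j) (h j)%:R ^- d.+1 * \1_(A j b) w.
  rewrite /V -sum1_card natr_sum big_mkcond/= mulr_suml; apply: eq_bigr => b _.
  by rewrite indicE unfold_in /bad; case: ifP => _; rewrite ?mul1r ?mulr1 ?mul0r ?mulr0.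
have mV j : measurable_fun setT (V ^~ j).
  under eq_fun do rewrite VE.
  apply: measurable_sum => b; apply: measurable_funM => //; exact: measurable_indic.
have EV j : (\int[P]_w (V w j)%:E <= (W * (C / (2 ^+ j) ^+ (3 * m).+1))%:E)%E.
  have mt b : measurable_fun setT (fun w => ((h j)%:R ^- d.+1 * \1_(A j b) w)%:E : \bar R).
    by apply/measurable_EFinP; apply: measurable_funM => //; exact: measurable_indic.
  have t0 b w : setT w -> (0 <= ((h j)%:R ^- d.+1 * \1_(A j b) w)%:E :> \bar R)%E.
    by move=> _; rewrite lee_fin mulr_ge0// invr_ge0 exprn_ge0.
  rewrite (eq_integral (fun w => \sum_(b <- enum {: index j})
      ((h j)%:R ^- d.+1 * \1_(A j b) w)%:E)%E); last first.
    by move=> w _; rewrite VE sumEFin big_enum.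
  rewrite ge0_integral_sum//.
  apply: (@le_trans _ _ (\sum_(b <- enum {: index j})
      ((h j)%:R ^- d.+1 * (C / (2 ^+ j) ^+ (3 * m).+1))%:E)%E).
    apply: lee_sum => b _; rewrite EFinM.
    under eq_integral do rewrite EFinM.
    have mI : measurable_fun setT (fun w => (\1_(A j b) w)%:E : \bar R).
      by apply/measurable_EFinP; exact: measurable_indic.
    have h1 : 0 <= (h j)%:R ^- d.+1 :> R by rewrite invr_ge0 exprn_ge0.
    rewrite ge0_integralZl_EFin// integral_indic// setIT lee_wpmul2l ?lee_fin//; exact: PA.
  rewrite sumEFin lee_fin big_const_seq count_predT iter_addr_0 -cardE -[leLHS]mulr_natl.
  rewrite [leLHS]mulrA; apply: ler_wpM2r; last exact: cardW.
  by rewrite divr_ge0// !exprn_ge0.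
pose S w := (\sum_(0 <= j <oo) ((8 ^+ j) ^+ m * V w j)%:E)%E.
have t0 w j : (0 <= ((8 ^+ j) ^+ m * V w j)%:E :> \bar R)%E.
  by case/andP: (VW w j) => V0 _; rewrite lee_fin mulr_ge0// !exprn_ge0.
have mt j : measurable_fun setT (fun w => ((8 ^+ j) ^+ m * V w j)%:E : \bar R).
  by apply/measurable_EFinP; exact: measurable_funM.
have mS : measurable_fun setT S.
  by apply: ge0_emeasurable_sum => [j w _ _|j _]; [exact: t0|exact: mt].
have S0 w : (0 <= S w)%E by apply: nneseries_ge0 => *; exact: t0.
have ES : (\int[P]_w S w <= (W * C * (1 - 2^-1)^-1)%:E)%E.
  rewrite integral_nneseries//; apply: nneseries_geometric_le => //.
  - by rewrite mulr_ge0// ltW.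
  - by rewrite invf_lt1// ltr1n.
  - by move=> j; apply: integral_ge0.
  move=> j; under eq_integral do rewrite EFinM.
  have V0 w : setT w -> (0 <= (V w j)%:E)%E by move=> _; rewrite lee_fin; case/andP: (VW w j).
  have mVj : measurable_fun setT (fun w => (V w j)%:E) by apply/measurable_EFinP.
  rewrite ge0_integralZl_EFin ?exprn_ge0//.
  apply: le_trans (lee_wpmul2l _ (EV j)) _; first by rewrite lee_fin !exprn_ge0.
  rewrite -EFinM lee_fin.
  (* The weight cancels all but one factor 2^j of the probability bound, which leaves a geometric
     series of ratio 1/2. *)
  have -> : (8 ^+ j) ^+ m = (2 ^+ j) ^+ (3 * m) :> R.
    rewrite exprM (_ : (2 ^+ j) ^+ 3 = 8 ^+ j)//.
    by rewrite exprAC; congr (_ ^+ j); ring.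
  have p2 : (2 ^+ j) ^+ (3 * m) != 0 :> R by rewrite !expf_neq0.
  have p1 : 2 ^+ j != 0 :> R by rewrite expf_neq0.
  rewrite exprS exprVn le_eqVlt; apply/orP; left; apply/eqP; field.
  by rewrite p1.
pose D : R := 4 ^+ m * W ^+ m.-1.
have D0 : 0 <= D by rewrite mulr_ge0 ?exprn_ge0// ltW.
pose a := @level_set_const R d r k.
have Iw w : (integral_geometric (level_set (fun t => X t w) u K) ^+ m <=
    (a ^+ m)%:E * ((2 ^+ m)%:E + D%:E * S w))%E.
  have I0 : (0 <= integral_geometric (level_set (fun t => X t w) u K))%E.
    exact: integral_geometric_ge0.
  have := @integral_geometric_le R d _ u K r k (sX w) r0 isT Kr (@bad w) (badP w).
  move=> /(le_expe m I0)/le_trans; apply; rewrite expe_EFinM.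
  apply: lee_wpmul2l; last exact: (@series_moment R (V w) W m m0 W0 (VW w)).
  by rewrite lee_fin exprn_ge0// level_set_const_ge0.
have aD : 0 <= a ^+ m by rewrite exprn_ge0// level_set_const_ge0.
have Im0 w : setT w -> (0 <= integral_geometric (level_set (fun t => X t w) u K) ^+ m)%E.
  by move=> _; rewrite expe_ge0// integral_geometric_ge0.
apply: le_lt_trans (@le_integral_nonmeasurable _ _ _ P setT _ _ Im0 (fun w _ => Iw w)) _.
have m2 : (0 <= 2 ^+ m :> R) by rewrite exprn_ge0.
have DS0 w : setT w -> (0 <= D%:E * S w)%E by move=> _; rewrite mule_ge0 ?lee_fin.
have mDS : measurable_fun setT (fun w => D%:E * S w)%E by exact: emeasurable_funM.
have S20 w : setT w -> (0 <= (2 ^+ m)%:E + D%:E * S w)%E.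
  by move=> Tw; rewrite adde_ge0 ?lee_fin ?DS0.
have mS2 : measurable_fun setT (fun w => (2 ^+ m)%:E + D%:E * S w)%E.
  exact: emeasurable_funD.
rewrite ge0_integralZl_EFin// ge0_integralD//.
rewrite integral_cst//= ge0_integralZl_EFin// [X in (_ * X + _)%E]probability_setT mule1.
rewrite lte_mul_pinfty ?lee_fin// lte_add_pinfty ?ltry// lte_mul_pinfty ?lee_fin//.
exact: le_lt_trans ES (ltry _).
Qed.

End moments.

Unset Implicit Arguments.
Set Strict Implicit.
Set Printing Implicit Defensive.

Theorem theorem5 (R : realType) (disp : measure_display)
    (Omega : measurableType disp) (P : probability Omega R)
    (d : nat) (hd : (1 <= d)%N)
    (X : 'rV[R]_d -> {RV P >-> R})
    (hgauss : gaussian_field X)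
    (hsmooth : forall w : Omega, smooth (fun t : 'rV[R]_d => X t w))
    (hvar : exists2 kappa : R, 0 < kappa &
              forall t : 'rV[R]_d, (kappa%:E < variance P (X t))%E)
    (u : R) (m : nat) (hm : (1 <= m)%N)
    (K : set 'rV[R]_d) (hK : compact K) :
  (\int[P]_w
     (integral_geometric (level_set (fun t : 'rV[R]_d => X t w) u K) ^+ m)
   < +oo)%E.
Proof.
case: d hd X hgauss hsmooth hvar K hK => // d _ X gX sX [kappa kappa0 kX] K cK.
have [M [_ MK]] := compact_bounded cK.
pose r := (Num.truncn (`|M| + 1)).+1.
have Kr x : K x -> `|x| <= r%:R.
  move=> Kx; apply: le_trans (MK (`|M| + 1) _ x Kx) _.
    by rewrite ltr_pwDr// ler_norm.
  by rewrite ltW// -truncn_le_nat.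
exact: (@level_set_moment _ _ _ P d (fun t w => X t w) (fun t => measurable_funPT (X t))
  gX sX kappa kappa0 kX u m r hm _ K Kr).
Qed.
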